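(* Let $\mathbb{F}\in\{\mathbb{R},\mathbb{C},\mathbb{H}\}$ and let $A\in\mathbb{F}_d[z,z^{-1}]$ satisfy $A^\dagger=A$ and be invertible on the unit circle, with symmetric partial indices $\mathcal{K}=\{\kappa_1\ge\dots\ge\kappa_d\}$ and signature $s$. Then there exists a factorization $A=A_+D_1A_+^\dagger$ with $A_+\in\mathbb{F}_d[z]$ invertible for all $|z|\le1$ and $$D_1=\sum_{m\in\mathcal{M}_+}\big(z^{\kappa_m}|\bar m\rangle\langle m|+z^{-\kappa_m}|m\rangle\langle\bar m|\big)\mathbf{1}_{\mathbb{F}}+\sum_{m\in\mathcal{M}_0}s_m|m\rangle\langle m|\mathbf{1}_{\mathbb{F}},$$ where $s_m\in\{+1,-1\}$ for $m\in\mathcal{M}_0$, the signs are ordered so that $s_m\le s_{m'}$ whenever $m<m'$ (all $-1$'s precede all $+1$'s), and $\sum_{m\in\mathcal{M}_0}s_m=s$.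
   Context: $\mathbb{F}_d[z,z^{-1}]$ denotes matrix Laurent polynomials $\sum_{r=p}^q a_rz^r$ with $a_r\in\mathbb{F}_d$ ($d\times d$ matrices over $\mathbb{F}$); $\mathbb{F}_d[z]$ those with only nonnegative powers. Quaternions are realized as real combinations of $\mathbf{1}_{\mathbb{H}}=I_2,\ i\sigma_x,\ i\sigma_y,\ \mathbf{k}=i\sigma_z$, so $\mathbb{H}_d\subset\mathbb{C}_{2d}$; $|m\rangle\langle m'|\mathbf{1}_{\mathbb{F}}$ is the matrix unit at position $(m,m')$ (a $2\times 2$ identity block for $\mathbb{H}$). For $A(z)=\sum a_rz^r$ define $A^\dagger(z):=\sum_r a_r^\dagger z^{-r}$ and $A^{\rm T}(z):=\sum_r a_r^{\rm T}z^{-r}$ (on $|z|=1$ these coincide with the pointwise conjugate transpose / transpose only for $A^\dagger$). A standard WH factorization of a complex matrix Laurent polynomial invertible on $|z|=1$ is $A=A_+DA_-$ with $A_+$ a polynomial in $z$ invertible for $|z|\le1$, $A_-$ a polynomial in $z^{-1}$ invertible for $|z^{-1}|\le 1$, $D=\mathrm{diag}(z^{\kappa_1},\dots)$, $\kappa_1\ge\kappa_2\ge\dots$; the partial indices $\kappa_m$ are unique. Symmetric partial indices $\mathcal{K}$: the standard partial indices if $\mathbb{F}=\mathbb{R},\mathbb{C}$; if $\mathbb{F}=\mathbb{H}$, the standard indices of $A\in\mathbb{C}_{2d}[z,z^{-1}]$ come in equal pairs and $\mathcal{K}$ keeps one of each pair. $\mathcal{M}_\pm=\{m:\pm\kappa_m>0\}$,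 $\mathcal{M}_0=\{m:\kappa_m=0\}$, and $\bar m:=d+1-m$. Signature: for $\mathbb{F}=\mathbb{R},\mathbb{C}$, $s$ is the number of positive minus the number of negative eigenvalues of $A(1)$; for $\mathbb{F}=\mathbb{H}$ it is half this quantity (computed for $A(1)\in\mathbb{C}_{2d}$). *)

(* Defs.v *)
From HB Require Import structures.
From mathcomp Require Import all_boot all_order all_algebra.
From mathcomp Require Import reals.
From mathcomp.real_closed Require Import complex.
From mathcomp Require Import zify.

Set Implicit Arguments.
Unset Strict Implicit.
Unset Printing Implicit Defensive.

Import Order.TTheory GRing.Theory Num.Theory.
Local Open Scope ring_scope.

(* A Laurent polynomial  sum_{r} a_r z^r  is stored as a lowest degree *)
(* lp_low and the list of coefficients [a_low; a_{low+1}; ...].        *)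
Record lpoly (R : realType) (n : nat) := LPoly {
  lp_low : int;
  lp_coef : seq 'M[R[i]]_n }.

Section Laurent.
Variables (R : realType) (n : nat).
Implicit Types (A : lpoly R n) (z : R[i]).

Definition lcoef A (r : int) : 'M[R[i]]_n :=
  match r - lp_low A with
  | Posz k => nth 0 (lp_coef A) k
  | Negz _ => 0
  end.

(* evaluation at a point z (meaningful for z != 0; for polynomials in z
   also at z = 0, where it gives the constant coefficient) *)
Definition leval A z : 'M[R[i]]_n :=
  \sum_(k < size (lp_coef A)) (z ^ (lp_low A + k%:Z)) *: (lp_coef A)`_k.

Definition mxdag (M : 'M[R[i]]_n) : 'M[R[i]]_n := (map_mx Num.conj M)^T.

(* A^dagger(z) := sum_r a_r^dagger z^{-r} *)
Definition ldag A : lpoly R n :=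
  LPoly (- (lp_low A + (size (lp_coef A))%:Z - 1))
        (rev (map mxdag (lp_coef A))).

Definition lsubinv A : lpoly R n :=
  LPoly (- (lp_low A + (size (lp_coef A))%:Z - 1)) (rev (lp_coef A)).

Definition is_polyz A : Prop := forall r : int, r < 0 -> lcoef A r = 0.

Definition inv_on_disk A : Prop :=
  forall z, `|z| <= 1 -> leval A z \in unitmx.

Definition inv_on_circle A : Prop :=
  forall z, `|z| = 1 -> leval A z \in unitmx.

(* Standard Wiener-Hopf factorization A = A_+ D A_- with partial indices
   k_1 >= k_2 >= ... ; equality of Laurent polynomials is expressed as
   equality of their values at every z <> 0. *)
Definition std_partial_indices A (k : 'I_n -> int) : Prop :=
  (forall i j : 'I_n, (i <= j)%N -> k j <= k i) /\
  exists Ap Am : lpoly R n,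
    [/\ is_polyz Ap, inv_on_disk Ap,
        is_polyz (lsubinv Am), inv_on_disk (lsubinv Am) &
        forall z, z != 0 ->
          leval A z = leval Ap z *m diag_mx (\row_i (z ^ k i)) *m leval Am z].

Definition mx_signature (M : 'M[R[i]]_n) (s : int) : Prop :=
  exists rs : seq R[i],
    char_poly M = \prod_(x <- rs) ('X - x%:P) /\
    s = (count (fun x => 0 < x) rs)%:Z - (count (fun x => x < 0) rs)%:Z.

End Laurent.

(* The three fields R, C, H; F_d is embedded in C_{d * bsz F}.         *)
Inductive fkind := FR | FC | FH.

Definition bsz (F : fkind) : nat := if F is FH then 2 else 1.

Lemma bsz_gt0 F : (0 < bsz F)%N.
Proof. by case: F. Qed.

Lemma blk_proof (F : fkind) (d : nat) (i : 'I_(d * bsz F)) : (i %/ bsz F < d)%N.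
Proof. by rewrite ltn_divLR ?bsz_gt0 // ltn_ord. Qed.

Definition blk (F : fkind) (d : nat) (i : 'I_(d * bsz F)) : 'I_d :=
  Ordinal (blk_proof i).

Lemma ix_proof (d : nat) (p : 'I_d) (e : bool) : (p * 2 + e < d * 2)%N.
Proof. have := ltn_ord p; case: e => /=; lia. Qed.

Definition ix (d : nat) (p : 'I_d) (e : bool) : 'I_(d * 2) :=
  Ordinal (ix_proof p e).

(* a complex matrix belongs to F_d:
   R: real entries; C: anything; H: every 2x2 block is a real combination
   of I, i sigma_x, i sigma_y, i sigma_z, i.e. of the form
   [[a, b], [-b^*, a^*]]. *)
Definition inF (R : realType) (F : fkind) (d : nat) :
  'M[R[i]]_(d * bsz F) -> Prop :=
  match F as F0 return 'M[R[i]]_(d * bsz F0) -> Prop with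
  | FR => fun M => forall i j, (M i j)^* = M i j
  | FC => fun _ => True
  | FH => fun M => forall p q : 'I_d,
      M (ix p true) (ix q true) = (M (ix p false) (ix q false))^* /\
      M (ix p true) (ix q false) = - (M (ix p false) (ix q true))^*
  end.

Definition lpoly_inF (R : realType) (F : fkind) (d : nat)
  (A : lpoly R (d * bsz F)) : Prop := forall r, inF (lcoef A r).

(* |m><m'| 1_F : matrix unit at (m, m') (a 2x2 identity block for H) *)
Definition munit (R : realType) (F : fkind) (d : nat) (m m' : 'I_d) :
  'M[R[i]]_(d * bsz F) :=
  \matrix_(i, j) (((blk i == m) && (blk j == m') &&
                   (i %% bsz F == j %% bsz F)%N)%:R : R[i]).

(* symmetric partial indices: the standard partial indices of A in
   C_{d * bsz F} are K_1, ..., K_d, each repeated bsz F times *)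
Definition sym_partial_indices (R : realType) (F : fkind) (d : nat)
  (A : lpoly R (d * bsz F)) (K : 'I_d -> int) : Prop :=
  std_partial_indices A (fun i => K (blk i)).

Definition signature (R : realType) (F : fkind) (d : nat)
  (A : lpoly R (d * bsz F)) (s : int) : Prop :=
  mx_signature (leval A 1) ((bsz F)%:Z * s).

Definition D1 (R : realType) (F : fkind) (d : nat) (K : 'I_d -> int)
  (sg : 'I_d -> int) (z : R[i]) : 'M[R[i]]_(d * bsz F) :=
  \sum_(m < d | 0 < K m)
     (z ^ K m *: @munit R F d (rev_ord m) m + z ^ (- K m) *: @munit R F d m (rev_ord m))
  + \sum_(m < d | K m == 0) (sg m)%:~R *: @munit R F d m m.

(* Main.v *)
(* On the unit circle z^-1 = z^*, so A = A_+ D A_- = A_-^* D^-1 A_+^* there.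
   By Liouville's theorem, here a divisibility statement between polynomials
   with no common root, two such factorizations differ by a factor
   U = A_+^-1 A_-^* that is a polynomial in z with deg U_ij <= k_i + k_j, and
   likewise for its inverse; hence A = A_+ H A_+^* with H = U D^-1 hermitian,
   block anti-triangular, and the partial indices are symmetric about 0.

   The three fields are treated uniformly: F_d is the fixed set of the
   conjugate-linear automorphism tau M = J conj(M) J^T (no condition for C).
   Liouville also gives tau A_+ = A_+ L; the average c A_+ + tau (c A_+) =
   A_+ (c + conj(c) L) is F-valued, and for a suitable scalar c it is still a
   Wiener-Hopf factor, since det (c + conj(c) L) is constant in z.

   A block congruence then reduces H: the index-zero block is a constant
   hermitian matrix, diagonalized over F; it clears the blocks next to it, and
   what is left in the positive block is split as T + T^* with T polynomial and
   absorbed by the anti-diagonal blocks.  The model is an involution at z = 1,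
   so that its trace is the signature of A(1) by Sylvester's law of inertia. *)

Require Import Defs.
From HB Require Import structures.
From mathcomp Require Import all_boot all_order all_algebra all_fingroup.
From mathcomp Require Import reals.
From mathcomp.real_closed Require Import complex.
From mathcomp Require Import zify ring.
Set Implicit Arguments.
Unset Strict Implicit.
Unset Printing Implicit Defensive.
Import Order.TTheory GRing.Theory Num.Theory.
Local Open Scope ring_scope.

(** * Laurent polynomials on the unit circle *)

(** The circle enters only as an infinite set of points at which [z^-1] is the conjugate of [z];
    identities proved there become identities of polynomials, so no analysis is involved. The scalar
    [c] of the averaging must be allowed to be complex: if [A_+] is [i] times a real matrix
    polynomial, then [L = -1] and the plain sum of [A_+] and its conjugate vanishes. An eigenbasis
    of a hermitian matrix need not respect [tau], so diagonalization over F goes by pivoting with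
    block units; it only uses that hermitian elements of F are real scalars. The congruence matrix
    has to be a polynomial in [z], invertible on the whole closed disk, including [z = 0] where the
    middle factor is singular or undefined. This dictates its shape: powers of [z] occur in it only
    on the block of positive indices. *)

Lemma poly_neq0_inj (K : idomainType) (p : {poly K}) (f : nat -> K) :
  injective f -> p != 0 -> exists t, p.[f t] != 0.
Proof.
move=> finj p0; pose s := map f (iota 0 (size p)).
have /allPn[_ /mapP[t _ ->] pt] : ~~ all (root p) s; last by exists t.
apply: contraNN p0 => all_s; rewrite (roots_geq_poly_eq0 all_s) //.
  by rewrite map_inj_uniq // iota_uniq.
by rewrite size_map size_iota.
Qed.

Section Circle.
Variable C : numClosedFieldType.
Implicit Types (z w c : C) (p q u v : {poly C}).

Lemma conj_circle z : `|z| = 1 -> z^* = z^-1.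
Proof. by move=> z1; rewrite invC_norm z1 expr1n invr1 mul1r. Qed.

Lemma circle_neq0 z : `|z| = 1 -> z != 0.
Proof. by move=> z1; rewrite -normr_eq0 z1 oner_eq0. Qed.

Lemma circle_conj z : `|z| = 1 -> `|z^*| = 1.
Proof. by rewrite norm_conjC. Qed.

Lemma circle_inv z : `|z| = 1 -> `|z^-1| = 1.
Proof. by move=> z1; rewrite normfV z1 invr1. Qed.

Let den_neq0 (t : nat) : 1 - 'i * t%:R != 0 :> C.
Proof.
apply/eqP => h; have := congr1 Num.conj h.
rewrite rmorphB rmorphM /= rmorph1 rmorph_nat conjCi rmorph0 mulNr opprK => h'.
have := congr2 +%R h h'; rewrite addrACA addNr addr0 add0r -(natrD _ 1 1).
by move/eqP; rewrite pnatr_eq0.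
Qed.

(** Cayley transform of the naturals: infinitely many distinct points of the circle, enough to force
    a polynomial that vanishes on the circle to be zero. *)
Let cay (t : nat) : C := (1 - 'i * t%:R)^* / (1 - 'i * t%:R).

Let cay_circle t : `|cay t| = 1.
Proof. by rewrite normrM normfV norm_conjC divff // normr_eq0 den_neq0. Qed.

Let cay_inj : injective cay.
Proof.
move=> s t /eqP; rewrite eqr_div ?den_neq0 // !rmorphB !rmorphM /= rmorph1.
rewrite !rmorph_nat conjCi !mulNr !opprK -subr_eq0.
have -> : (1 + 'i * s%:R) * (1 - 'i * t%:R) - (1 + 'i * t%:R) * (1 - 'i * s%:R)
   = 2%:R * 'i * (s%:R - t%:R) :> C by ring.
by rewrite !mulf_eq0 pnatr_eq0 (negPf (neq0Ci C)) subr_eq0 eqr_nat => /eqP.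
Qed.

Lemma poly_circle0 p : (forall z, `|z| = 1 -> p.[z] = 0) -> p = 0.
Proof.
move=> h; apply/eqP/negPn/negP => /(poly_neq0_inj cay_inj)[t].
by rewrite h ?cay_circle ?eqxx.
Qed.

Lemma poly_circle_inj p q :
  (forall z, `|z| = 1 -> p.[z] = q.[z]) -> p = q.
Proof.
move=> h; apply/eqP; rewrite -subr_eq0; apply/eqP/poly_circle0 => z z1.
by rewrite !hornerE h // subrr.
Qed.

Definition revp N p : {poly C} := \poly_(r < N.+1) p`_(N - r).

Lemma size_revp N p : (size (revp N p) <= N.+1)%N.
Proof. exact: size_poly. Qed.

Lemma horner_revp N p z : (size p <= N.+1)%N -> z != 0 ->
  (revp N p).[z] = z ^+ N * p.[z^-1].
Proof.
move=> sp z0; rewrite horner_poly (reindex_inj rev_ord_inj) /=.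
rewrite (horner_coef_wide _ sp) mulr_sumr; apply: eq_bigr => i _.
have iN : (i <= N)%N by rewrite -ltnS.
by rewrite subSS subKn // exprB ?unitfE // mulrCA exprVn.
Qed.

(** Multiplied by a power of [z], both sides become polynomials that agree on the circle, hence have
    equal coefficients; [z ^ k] times a polynomial in [z^-1] has no power above [k]. For negative
    [k] this yields [p = 0]. *)
Lemma size_laurent p q (k : int) :
  (forall z, `|z| = 1 -> p.[z] = z ^ k * q.[z^-1]) ->
  forall r : nat, k < r%:Z -> p`_r = 0.
Proof.
move=> pq r kr; set N := size q.
have sq : (size q <= N.+1)%N by rewrite /N.
case: k pq kr => k pq kr.
  have : 'X^N * p = 'X^k * revp N q.
    apply: poly_circle_inj => z z1; have z0 := circle_neq0 z1.
    rewrite !hornerM !hornerXn pq // horner_revp //.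
    by rewrite -exprnP mulrCA.
  move/(congr1 (fun p : {poly C} => p`_(N + r))); rewrite !coefXnM.
  rewrite ltnNge leq_addr /= addKn => ->; case: ifP => // _.
  by rewrite nth_default // (leq_trans (size_revp _ _)) //; lia.
have : 'X^(N + k.+1) * p = revp N q.
  apply: poly_circle_inj => z z1; have z0 := circle_neq0 z1.
  rewrite !hornerM !hornerXn pq // horner_revp // NegzE exprD -exprnN.
  by rewrite mulrA -[_ * _ * z ^- _]mulrA divff ?mulr1 // expf_neq0.
move/(congr1 (fun p : {poly C} => p`_(N + k.+1 + r))); rewrite !coefXnM.
rewrite ltnNge leq_addr /= addKn => ->.
by rewrite nth_default // (leq_trans (size_revp _ _)) //; lia.
Qed.

Lemma coprimep_closed p q : (forall x, root p x -> ~~ root q x) -> coprimep p q.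
Proof.
move=> h; rewrite /coprimep; apply/negPn/negP => /closed_rootP[x].
by rewrite root_gcd => /andP[/h /negPf->].
Qed.

(* The roots of [e(1/z)] lie inside the disk, those of [d] outside. *)
Let half_liouville (d e u v : {poly C}) (k : int) :
  (forall z, `|z| <= 1 -> d.[z] != 0) -> (forall z, `|z| <= 1 -> e.[z] != 0) ->
  (forall z, `|z| = 1 -> e.[z^-1] * u.[z] = d.[z] * (z ^ k * v.[z^-1])) ->
  d %| u.
Proof.
move=> d0 e0 H.
have en0 : e != 0 by apply: contraTneq (e0 0 _) => [->|]; rewrite ?horner0 ?eqxx ?normr0.
pose es := revp (size e).-1 e.
have sz : (size e <= (size e).-1.+1)%N by rewrite leqSpred.
have cop : coprimep d es.
  apply: coprimep_closed => x /rootP dx; rewrite rootE.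
  have x1 : 1 < `|x|.
    rewrite real_ltNge ?rpred1 ?normr_real //; apply/negP => /d0.
    by rewrite dx eqxx.
  have x0 : x != 0 by rewrite -normr_gt0 (lt_trans ltr01).
  rewrite horner_revp // mulf_neq0 ?expf_neq0 // e0 // normfV.
  by rewrite invf_le1 ?(lt_trans ltr01) // ltW.
have copX m : coprimep d 'X^m.
  by apply: coprimep_expr; rewrite coprimepX rootE d0 // normr0.
(* [N] clears the denominators of [v.[z^-1]] and [m] makes the exponent [k + m] nonnegative. In the
   resulting identity [E], the factors [es] and ['X^(N + m)] beside [u] are coprime to [d]. *)
pose N := size v; pose m := `|k|%N.
have sv : (size v <= N.+1)%N by rewrite /N.
have E : u * es * 'X^(N + m) =
   d * (revp N v * 'X^(absz (k + m%:Z)) * 'X^((size e).-1)).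
  apply: poly_circle_inj => z z1; have z0 := circle_neq0 z1.
  rewrite !hornerM !hornerXn !horner_revp //.
  have -> : z ^+ absz (k + m%:Z) = z ^ k * z ^+ m.
    have km : (absz (k + m%:Z))%:Z = k + m%:Z by rewrite gez0_abs // /m; lia.
    by rewrite [LHS]exprnP km expfzDr // exprnP.
  rewrite [u.[z] * _]mulrC -!mulrA [e.[_] * _]mulrA H // exprD; ring.
rewrite -(Gauss_dvdpl u cop) -(Gauss_dvdpl _ (copX (N + m)%N)) E.
exact: dvdp_mulr.
Qed.

Lemma scalar_liouville (d e u v : {poly C}) (k : int) :
  (forall z, `|z| <= 1 -> d.[z] != 0) -> (forall z, `|z| <= 1 -> e.[z] != 0) ->
  (forall z, `|z| = 1 -> e.[z^-1] * u.[z] = d.[z] * (z ^ k * v.[z^-1])) ->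
  [/\ d %| u, e %| v &
   forall z, `|z| = 1 -> (u %/ d).[z] = z ^ k * (v %/ e).[z^-1]].
Proof.
move=> d0 e0 H.
have du : d %| u by apply: half_liouville H.
have ev : e %| v.
  (* The hypothesis is invariant under replacing [z] by [z^-1] while exchanging [(d, u)] with
     [(e, v)]. *)
  apply: (@half_liouville e d v u k) => // z z1.
  have z0 := circle_neq0 z1.
  have := H _ (circle_inv z1); rewrite invrK => E; rewrite mulrCA E.
  have zk : z ^ k * z^-1 ^ k = 1 by rewrite exprz_inv -expfzDr // subrr expr0z.
  by rewrite mulrCA [z ^ k * _]mulrA zk mul1r.
split=> // z z1; have := H z z1; rewrite -{1}(divpK du) -{1}(divpK ev) !hornerM.
move=> E; apply: (mulfI (d0 z _)); first by rewrite z1.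
apply: (mulfI (e0 z^-1 _)); first by rewrite circle_inv.
set U := (u %/ d).[z] in E *; set V := (v %/ e).[_] in E *.
by rewrite [d.[z] * U]mulrC E; ring.
Qed.
End Circle.

(** * Matrix polynomials and the Liouville argument *)

Definition ev (C : comNzRingType) n (P : 'M[{poly C}]_n) (z : C) : 'M[C]_n :=
  map_mx (horner_eval z) P.
Definition const_pmx (C : comNzRingType) n (M : 'M[C]_n) : 'M[{poly C}]_n :=
  map_mx polyC M.
Definition dg (C : numClosedFieldType) m n (M : 'M[C]_(m, n)) : 'M[C]_(n, m) :=
  (map_mx Num.conj M)^T.
(** The powers of [z] are kept, so this is again a polynomial; the Laurent dagger is its value at
    [z^-1]. *)
Definition dgp (C : numClosedFieldType) n (P : 'M[{poly C}]_n) :=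
  (map_mx (map_poly Num.conj) P)^T.
Definition Dz (C : fieldType) n (k : 'I_n -> int) (z : C) : 'M[C]_n :=
  diag_mx (\row_i z ^ k i).

Section Eval.
Variables (C : comNzRingType) (n : nat).
Implicit Types (P Q : 'M[{poly C}]_n) (z : C).

Lemma evM P Q z : ev (P *m Q) z = ev P z *m ev Q z. Proof. exact: map_mxM. Qed.
Lemma evD P Q z : ev (P + Q) z = ev P z + ev Q z. Proof. exact: map_mxD. Qed.
Lemma evB P Q z : ev (P - Q) z = ev P z - ev Q z. Proof. exact: map_mxB. Qed.
Lemma ev1 z : ev (1%:M : 'M_n) z = 1%:M. Proof. exact: map_mx1. Qed.
Lemma ev_det P z : \det (ev P z) = (\det P).[z]. Proof. exact: det_map_mx. Qed.
Lemma ev_const M z : ev (@const_pmx C n M) z = M.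
Proof. by apply/matrixP => i j; rewrite !mxE /horner_eval hornerC. Qed.
Lemma const_pmxM (M N : 'M[C]_n) : const_pmx (M *m N) = const_pmx M *m const_pmx N.
Proof. exact: map_mxM. Qed.
Lemma ev_scale p P z : ev (p *: P) z = p.[z] *: ev P z.
Proof. by apply/matrixP => i j; rewrite !mxE /horner_eval hornerM. Qed.
Lemma evE P z i j : ev P z i j = (P i j).[z]. Proof. by rewrite mxE. Qed.

End Eval.

Section Dagger.
Variables (C : numClosedFieldType).

Lemma dgE m n (A : 'M[C]_(m, n)) i j : dg A i j = (A j i)^*.
Proof. by rewrite !mxE. Qed.
Lemma dgM m n p (A : 'M[C]_(m, n)) (B : 'M_(n, p)) : dg (A *m B) = dg B *m dg A.
Proof. by rewrite /dg map_mxM trmx_mul. Qed.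
Lemma dgK m n : cancel (@dg C m n) (@dg C n m).
Proof. by move=> A; apply/matrixP => i j; rewrite !dgE conjCK. Qed.
Lemma dgD m n (A B : 'M[C]_(m, n)) : dg (A + B) = dg A + dg B.
Proof. by rewrite /dg map_mxD linearD. Qed.
Lemma dgB m n (A B : 'M[C]_(m, n)) : dg (A - B) = dg A - dg B.
Proof. by rewrite /dg map_mxB linearB. Qed.
Lemma dgZ m n c (A : 'M[C]_(m, n)) : dg (c *: A) = c^* *: dg A.
Proof. by rewrite /dg map_mxZ linearZ. Qed.
Lemma dg0 m n : dg (0 : 'M[C]_(m, n)) = 0.
Proof. by rewrite /dg map_mx0 trmx0. Qed.
Lemma dg1 n : dg (1%:M : 'M[C]_n) = 1%:M.
Proof. by rewrite /dg map_mx1 trmx1. Qed.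
Lemma dg_unit n (A : 'M[C]_n) : (dg A \in unitmx) = (A \in unitmx).
Proof. by rewrite unitmx_tr map_unitmx. Qed.

Lemma ev_dgp n (P : 'M[{poly C}]_n) z : ev (dgp P) z = dg (ev P z^*).
Proof.
apply/matrixP => i j; rewrite !mxE /horner_eval -[z in LHS]conjCK horner_map.
by [].
Qed.

Lemma ev_inj n (P Q : 'M[{poly C}]_n) :
  (forall z, `|z| = 1 -> ev P z = ev Q z) -> P = Q.
Proof.
move=> h; apply/matrixP => i j; apply: poly_circle_inj => z z1.
by rewrite -!evE h.
Qed.

Lemma Dz_unit n (k : 'I_n -> int) (z : C) : z != 0 -> Dz k z \in unitmx.
Proof.
move=> z0; rewrite unitmxE det_diag unitfE; apply/prodf_neq0 => i _.
by rewrite mxE expfz_neq0.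
Qed.

Lemma mul_Dz n (k : 'I_n -> int) (z : C) (M : 'M[C]_n) i j :
  (Dz k z *m M) i j = z ^ k i * M i j.
Proof. by rewrite mul_diag_mx !mxE. Qed.

Lemma mul_mx_Dz n (k : 'I_n -> int) (z : C) (M : 'M[C]_n) i j :
  (M *m Dz k z) i j = M i j * z ^ k j.
Proof. by rewrite mul_mx_diag !mxE. Qed.

Lemma dg_Dz n (k : 'I_n -> int) (z : C) : dg (Dz k z) = Dz k z^*.
Proof.
apply/matrixP => i j; rewrite dgE !mxE eq_sym; case: eqP => [->|_].
  by rewrite !mulr1n fmorphXz.
by rewrite !mulr0n rmorph0.
Qed.

Lemma DzV n (k : 'I_n -> int) (z : C) : z != 0 ->
  Dz k z *m Dz (fun i => - k i) z = 1%:M.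
Proof.
move=> z0; rewrite mulmx_diag -diag_const_mx; congr diag_mx.
by apply/rowP => i; rewrite !mxE -expfzDr // subrr expr0z.
Qed.

Definition disk_unit n (P : 'M[{poly C}]_n) :=
  forall z, `|z| <= 1 -> ev P z \in unitmx.

Lemma disk_det n (P : 'M[{poly C}]_n) :
  disk_unit P -> forall z, `|z| <= 1 -> (\det P).[z] != 0.
Proof. by move=> h z /h; rewrite unitmxE unitfE ev_det. Qed.

Lemma disk_det0 n (P : 'M[{poly C}]_n) : disk_unit P -> \det P != 0.
Proof.
move/disk_det => h; apply/eqP => P0; have := h 0.
by rewrite P0 horner0 eqxx normr0 ler01 => /(_ isT).
Qed.

Lemma scale_inj (K : idomainType) m n (a : K) :
  a != 0 -> injective (fun M : 'M[K]_(m, n) => a *: M).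
Proof.
move=> a0 M N /matrixP h; apply/matrixP => i j.
by have := h i j; rewrite !mxE => /(mulfI a0).
Qed.

Lemma mulmxI_det (K : idomainType) n (P L M : 'M[K]_n) :
  \det P != 0 -> P *m L = P *m M -> L = M.
Proof.
move=> P0 /(congr1 (mulmx (\adj P))); rewrite !mulmxA mul_adj_mx !mul_scalar_mx.
exact: scale_inj.
Qed.

(* Liouville: the common value of [p^-1 p'] and [Dk q' q^-1 Dm^-1] is analytic
   in the disk and, up to powers of [z], outside of it. *)
Lemma liouville n (p q p' q' : 'M[{poly C}]_n) (k m : 'I_n -> int) :
  disk_unit p -> disk_unit q ->
  (forall z, `|z| = 1 ->
     ev p' z *m Dz m z *m ev q z^-1 = ev p z *m Dz k z *m ev q' z^-1) ->
  exists L Lh : 'M[{poly C}]_n, [/\ p' = p *m L, q' = Lh *m q &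
    forall z, `|z| = 1 -> ev L z *m Dz m z = Dz k z *m ev Lh z^-1].
Proof.
move=> hp hq H; pose u := \adj p *m p'; pose v := q' *m \adj q.
have E z : `|z| = 1 -> (\det q).[z^-1] *: (ev u z *m Dz m z) =
    (\det p).[z] *: (Dz k z *m ev v z^-1).
  move=> z1; have := H z z1.
  move/(congr1 (fun M => ev (\adj p) z *m M *m ev (\adj q) z^-1)).
  have evs a w : ev (a%:M : 'M[{poly C}]_n) w = (a.[w])%:M.
    by rewrite /ev map_scalar_mx.
  have -> : ev (\adj p) z *m (ev p' z *m Dz m z *m ev q z^-1) *m ev (\adj q) z^-1
      = ev u z *m Dz m z *m ev (\det q)%:M z^-1.
    by rewrite -(mul_mx_adj q) !evM !mulmxA.
  have -> : ev (\adj p) z *m (ev p z *m Dz k z *m ev q' z^-1) *m ev (\adj q) z^-1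
      = ev (\det p)%:M z *m (Dz k z *m ev v z^-1).
    by rewrite -(mul_adj_mx p) !evM !mulmxA.
  by rewrite !evs mul_scalar_mx mul_mx_scalar.
have F i j : [/\ \det p %| u i j, \det q %| v i j &
    forall z, `|z| = 1 -> (u i j %/ \det p).[z] =
      z ^ (k i - m j) * (v i j %/ \det q).[z^-1]].
  apply: scalar_liouville => [||z z1]; [exact: disk_det|exact: disk_det|].
  have z0 := circle_neq0 z1.
  have /matrixP/(_ i j) := E z z1; rewrite [LHS]mxE [RHS]mxE mul_Dz mul_mx_Dz !evE.
  move=> /(congr1 (fun x => x * z ^ (- m j))).
  rewrite -!mulrA -expfzDr // subrr expr0z mulr1 => ->.
  by rewrite expfzDr //; ring.
pose L : 'M_n := \matrix_(i, j) (u i j %/ \det p).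
pose Lh : 'M_n := \matrix_(i, j) (v i j %/ \det q).
have Lu : \det p *: L = u.
  by apply/matrixP => i j; rewrite 2!mxE mulrC; have [/divpK] := F i j.
have Lhv : \det q *: Lh = v.
  by apply/matrixP => i j; rewrite 2!mxE mulrC; have [_ /divpK] := F i j.
exists L, Lh; split.
- apply: (scale_inj (disk_det0 hp)); rewrite /= scalemxAr Lu.
  by rewrite mulmxA mul_mx_adj mul_scalar_mx.
- apply: (scale_inj (disk_det0 hq)); rewrite /= scalemxAl Lhv.
  by rewrite -mulmxA mul_adj_mx mul_mx_scalar.
move=> z z1; apply/matrixP => i j; rewrite mul_mx_Dz mul_Dz !evE.
have -> : L i j = u i j %/ \det p by rewrite mxE.
have -> : Lh i j = v i j %/ \det q by rewrite mxE.
have [_ _ ->] // := F i j; have z0 := circle_neq0 z1.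
by rewrite mulrAC -expfzDr // subrK.
Qed.

End Dagger.

(** * Real and quaternionic structures *)

Definition tau (C : numClosedFieldType) n (J M : 'M[C]_n) : 'M[C]_n :=
  J *m map_mx Num.conj M *m J^T.
Definition taup (C : numClosedFieldType) n (J : 'M[C]_n) (P : 'M[{poly C}]_n) :=
  const_pmx J *m map_mx (map_poly Num.conj) P *m const_pmx J^T.
(** A real orthogonal [J] makes [tau] multiplicative and compatible with [dg]; [J *m J = s] with [s]
    equal to 1 or -1 makes it an involution. The sign is 1 for the real structure and -1 for the
    quaternionic one. *)
Definition structure_mx (C : numClosedFieldType) n (J : 'M[C]_n) : Prop :=
  [/\ J *m J^T = 1%:M, map_mx Num.conj J = J &
      exists2 s : C, s * s = 1 & J *m J = s%:M].

Section Tau.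
Variables (C : numClosedFieldType) (n : nat) (J : 'M[C]_n).
Hypothesis HJ : structure_mx J.
Implicit Types (M N : 'M[C]_n) (P Q : 'M[{poly C}]_n) (z c : C).

Let JJt : J *m J^T = 1%:M. Proof. by case: HJ. Qed.
Let JtJ : J^T *m J = 1%:M. Proof. exact: mulmx1C. Qed.
Let Jr : map_mx Num.conj J = J. Proof. by case: HJ. Qed.

Lemma tauM M N : tau J (M *m N) = tau J M *m tau J N.
Proof. by rewrite /tau map_mxM !mulmxA -[_ *m J^T *m J]mulmxA JtJ mulmx1. Qed.
Lemma tauD M N : tau J (M + N) = tau J M + tau J N.
Proof. by rewrite /tau map_mxD mulmxDr mulmxDl. Qed.
Lemma tauB M N : tau J (M - N) = tau J M - tau J N.
Proof. by rewrite /tau map_mxB mulmxBr mulmxBl. Qed.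
Lemma tauZ c M : tau J (c *: M) = c^* *: tau J M.
Proof. by rewrite /tau map_mxZ -scalemxAr -scalemxAl. Qed.
Lemma tau1 : tau J 1%:M = 1%:M.
Proof. by rewrite /tau map_mx1 mulmx1. Qed.
Lemma tauK : involutive (tau J).
Proof.
move=> M; rewrite /tau !map_mxM -map_trmx Jr -map_mx_comp.
have -> : map_mx (Num.conj \o Num.conj) M = M.
  by apply/matrixP => i j; rewrite mxE /= conjCK.
case: HJ => _ _ [s ss JJ].
rewrite !mulmxA JJ -[_ *m J^T *m J^T]mulmxA -trmx_mul JJ tr_scalar_mx.
by rewrite mul_scalar_mx mul_mx_scalar scalerA ss scale1r.
Qed.
Lemma tau_dg M : tau J (dg M) = dg (tau J M).
Proof.
by rewrite /tau /dg !map_mxM -!map_trmx Jr !trmx_mul !trmxK mulmxA.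
Qed.

Lemma ev_taup P z : ev (taup J P) z = tau J (ev P z^*).
Proof.
rewrite /taup !evM !ev_const /tau; congr (_ *m _ *m _).
apply/matrixP => i j; rewrite !mxE /horner_eval -[z in LHS]conjCK horner_map.
by [].
Qed.
Lemma taupM P Q : taup J (P *m Q) = taup J P *m taup J Q.
Proof. by apply: ev_inj => z _; rewrite evM !ev_taup evM tauM. Qed.

(** For [c = 1 + 'i * t] with [t] real, the determinant is a polynomial in [t]. At the non-real
    point [t = - 'i] the coefficient of [M] vanishes and the matrix is twice the identity, so the
    polynomial is nonzero, and some natural number is not a root. *)
Lemma exists_unit_comb M : exists c : C, c%:M + c^* *: M \in unitmx.
Proof.
pose N : 'M[{poly C}]_n := (1 + 'i *: 'X)%:M + (1 - 'i *: 'X) *: const_pmx M.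
have evN z : ev N z = (1 + 'i * z)%:M + (1 - 'i * z) *: M.
  by rewrite /N evD ev_scale ev_const /ev map_scalar_mx /= /horner_eval !hornerE.
have [t] : exists t : nat, (\det N).[t%:R] != 0.
  apply: poly_neq0_inj; first by move=> s t /eqP; rewrite eqr_nat => /eqP.
  have : (\det N).[- 'i] != 0.
    rewrite -ev_det evN mulrN -expr2 sqrCi opprK subrr scale0r addr0 det_scalar.
    by rewrite expf_neq0 // -(natrD _ 1 1) pnatr_eq0.
  by apply: contraNneq => ->; rewrite horner0.
rewrite -ev_det evN => Nt; exists (1 + 'i * t%:R); rewrite unitmxE unitfE.
suff -> : (1 + 'i * t%:R)^* = 1 - 'i * t%:R :> C by [].
by rewrite rmorphD rmorphM /= rmorph1 conjCi rmorph_nat mulNr.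
Qed.

Lemma laurent_const (p q : {poly C}) :
  (forall z, `|z| = 1 -> p.[z] = q.[z^-1]) -> p = (p.[0])%:P.
Proof.
move=> pq; apply/polyP => r; rewrite coefC; case: r => [|r] /=; first by rewrite horner_coef0.
apply: (@size_laurent _ p q 0) => // z z1.
by rewrite expr0z mul1r pq.
Qed.

Lemma wh_tau_fixed (P Q : 'M[{poly C}]_n) (k : 'I_n -> int) (a : C -> 'M[C]_n) :
  disk_unit P -> disk_unit Q ->
  (forall z, `|z| = 1 -> a z = ev P z *m Dz k z *m ev Q z^-1) ->
  (forall z, `|z| = 1 -> tau J (a z^*) = a z) ->
  (forall z, `|z| = 1 -> tau J (Dz k z^*) = Dz k z) ->
  exists P' Q', [/\ disk_unit P', disk_unit Q',
    (forall z, `|z| = 1 -> a z = ev P' z *m Dz k z *m ev Q' z^-1) &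
    taup J P' = P'].
Proof.
move=> hP hQ aE ta tD.
have htQ : disk_unit (taup J Q).
  move=> z z1; rewrite ev_taup /tau !unitmx_mul map_unitmx hQ ?norm_conjC //.
  by have [-> ->] := mulmx1_unit JJt.
(* Since [a] and the middle factor are invariant, [tau] turns the given factorization into a second
   one, with outer factors [taup J P] and [taup J Q]. *)
have [|L [Lh [PL QL LD]]] := @liouville C n P (taup J Q) (taup J P) Q k k hP htQ.
  move=> z z1; rewrite !ev_taup -tD // -!tauM fmorphV -aE ?circle_conj //.
  by rewrite ta // tD // aE.
have [c] := exists_unit_comb (ev L 0).
pose G : 'M[{poly C}]_n := (c%:P)%:M + (c^*)%:P *: L.
pose Gh : 'M[{poly C}]_n := (c%:P)%:M + (c^*)%:P *: Lh.
have evG z : ev G z = c%:M + c^* *: ev L z.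
  by rewrite evD ev_scale hornerC /ev map_scalar_mx /= /horner_eval hornerC.
have evGh z : ev Gh z = c%:M + c^* *: ev Lh z.
  by rewrite evD ev_scale hornerC /ev map_scalar_mx /= /horner_eval hornerC.
have GD z : `|z| = 1 -> ev G z *m Dz k z = Dz k z *m ev Gh z^-1.
  move=> z1; rewrite evG evGh mulmxDl mulmxDr -scalemxAl LD // -scalemxAr.
  by rewrite mul_scalar_mx mul_mx_scalar.
rewrite -evG unitmxE ev_det unitfE => G0.
(* The powers of [z] cancel in the determinant, so [\det G] is a polynomial in [z] and also in
   [z^-1], hence constant. Its value at 0, nonzero by the choice of [c], makes [G] and [Gh]
   invertible everywhere. *)
have detG z : `|z| = 1 -> (\det G).[z] = (\det Gh).[z^-1].
  move=> z1; have := congr1 determinant (GD z z1); rewrite !det_mulmx !ev_det.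
  rewrite mulrC; apply: mulfI; rewrite -unitfE -unitmxE.
  exact/Dz_unit/circle_neq0.
have cG := laurent_const detG.
have cGh : \det Gh = ((\det G).[0])%:P.
  apply: poly_circle_inj => z z1; rewrite -[z]invrK -detG ?circle_inv // cG.
  by rewrite !hornerC.
have uG z : ev G z \in unitmx by rewrite unitmxE ev_det cG hornerC unitfE.
have uGh : Gh \in unitmx by rewrite unitmxE cGh rmorph_unit // unitfE.
(* Passing through the middle factor turns [G] into [Gh], which the inverse then cancels. *)
exists (P *m G), (invmx Gh *m Q); split.
- by move=> z z1; rewrite evM unitmx_mul hP // uG.
- move=> z z1; rewrite evM unitmx_mul hQ // andbT.
  have /mulmx1_unit[] // : ev (invmx Gh) z *m ev Gh z = 1%:M.
  by rewrite -evM mulVmx // ev1.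
- move=> z z1; rewrite !evM -[_ *m ev G z *m _]mulmxA GD // -!mulmxA.
  rewrite [ev Gh _ *m _]mulmxA -evM mulmxV // ev1 mul1mx.
  by rewrite aE // -!mulmxA.
have -> : P *m G = c%:P *: P + (c^*)%:P *: taup J P.
  by rewrite PL mulmxDr mul_mx_scalar -scalemxAr.
apply: ev_inj => z _; rewrite ev_taup !evD !ev_scale !hornerC !ev_taup tauD.
by rewrite !tauZ tauK !conjCK addrC.
Qed.

End Tau.

(** * Symmetry of the partial indices *)

Section Indices.

Lemma det_neq0_perm (K : idomainType) n (M : 'M[K]_n) :
  \det M != 0 -> exists s : 'S_n, forall i, M i (s i) != 0.
Proof.
move=> M0; have [s /andP[_ /prodf_neq0 sP]|h] := pickP (fun s : 'S_n =>
    true && (\prod_i M i (s i) != 0)); first by exists s => i; apply: sP.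
case/eqP: M0; rewrite /determinant big1 // => s _.
by have /negbT := h s; rewrite negbK => /eqP ->; rewrite mulr0.
Qed.

Lemma sorted_enum_ord n : sorted (fun i j : 'I_n => (i <= j)%N) (enum 'I_n).
Proof.
have := iota_sorted 0 n; rewrite -val_enum_ord sorted_map.
by apply: sub_sorted => i j.
Qed.

Lemma perm_eq_map_inj (T : finType) (S : eqType) (f : T -> S) (s : T -> T) :
  injective s -> perm_eq [seq f (s i) | i <- enum T] [seq f i | i <- enum T].
Proof.
move=> sinj; rewrite (map_comp f s); apply: perm_map; apply: uniq_perm.
- by rewrite map_inj_uniq // enum_uniq.
- exact: enum_uniq.
by move=> i; rewrite mem_enum [RHS]/= -(f_finv sinj i) map_f // mem_enum.
Qed.

(** Negating and reversing the list of indices leaves it non-increasing, and [s] shows that it is a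
    rearrangement of the original; two sorted lists with the same elements coincide. *)
Lemma antisym_sorted n (k : 'I_n -> int) (s : 'S_n) :
  (forall i j : 'I_n, (i <= j)%N -> k j <= k i) ->
  (forall i, k (s i) = - k i) -> forall i, k (rev_ord i) = - k i.
Proof.
move=> kd ks i.
suff : [seq k i | i <- enum 'I_n] = [seq - k (rev_ord i) | i <- enum 'I_n].
  by move/eq_in_map => /(_ i (mem_enum _ i)) ->; rewrite opprK.
have srt (f : 'I_n -> int) : (forall i j : 'I_n, (i <= j)%N -> f j <= f i) ->
    sorted (fun x y : int => y <= x) [seq f i | i <- enum 'I_n].
  move=> fd; rewrite sorted_map.
  by apply: sub_sorted (sorted_enum_ord n) => x y; apply: fd.
apply: (sorted_eq _ _ (srt _ kd)) => [x y z xy yz|x y||].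
- exact: le_trans yz xy.
- by rewrite andbC => /le_anti.
- by apply: srt => x y xy; rewrite lerN2 kd //= leq_sub2l.
rewrite perm_sym (perm_trans (perm_eq_map_inj (fun i => - k i) rev_ord_inj)) //.
rewrite -(eq_map (f := fun i => k (s i))); last by move=> j; rewrite ks.
exact: (perm_eq_map_inj k (@perm_inj _ s)).
Qed.

(** A nonzero term in the Leibniz formula for [\det U] is a permutation [s] with all
    [k i + k (s i) >= 0]; one for [\det V] is a [t] with all [k i + k (t i) <= 0]. Both families sum
    to twice the sum of [k], so every term of the first is zero. *)
Lemma antisym_indices (K : idomainType) n (U V : 'M[K]_n) (k : 'I_n -> int) :
  (forall i j : 'I_n, (i <= j)%N -> k j <= k i) -> U *m V = 1%:M ->
  (forall i j, k i + k j < 0 -> U i j = 0) ->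
  (forall i j, 0 < k i + k j -> V i j = 0) ->
  forall i, k (rev_ord i) = - k i.
Proof.
move=> kd UV U0 V0.
have : \det U * \det V != 0 by rewrite -det_mulmx UV det1 oner_neq0.
rewrite mulf_eq0 negb_or => /andP[/det_neq0_perm[s sP] /det_neq0_perm[t tP]].
have sum2 (r : 'S_n) : \sum_i (k i + k (r i)) = \sum_i (k i + k i).
  rewrite !big_split /=; congr (_ + _).
  by rewrite [RHS](reindex_inj (@perm_inj _ r)).
have ge0 i : 0 <= k i + k (s i).
  by rewrite leNgt; apply: contra (sP i) => /U0 ->.
have le0 i : k i + k (t i) <= 0.
  by rewrite leNgt; apply: contra (tP i) => /V0 ->.
have S0 : \sum_i (k i + k (s i)) = 0.
  apply/le_anti; rewrite sumr_ge0 // andbT sum2 -(sum2 t) -oppr_ge0 -sumrN.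
  by apply: sumr_ge0 => i _; rewrite oppr_ge0.
apply: (antisym_sorted (s := s) kd) => i; apply/eqP.
rewrite -addr_eq0 addrC; apply/eqP.
exact: (psumr_eq0P (fun i _ => ge0 i) S0).
Qed.

End Indices.

(** The dagger of the factorization is another one, with outer factors [dgp Q], [dgp P] and
    exponents [- k]. Liouville applied in both directions gives the transition matrices [U] and [V],
    and [size_laurent] bounds the degrees of their entries. *)
Lemma wh_symmetrize (C : numClosedFieldType) n (P Q : 'M[{poly C}]_n)
    (k : 'I_n -> int) (a : C -> 'M[C]_n) :
  disk_unit P -> disk_unit Q ->
  (forall z, `|z| = 1 -> a z = ev P z *m Dz k z *m ev Q z^-1) ->
  (forall z, `|z| = 1 -> dg (a z) = a z) ->
  exists U V : 'M[{poly C}]_n, [/\ U *m V = 1%:M,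
    (forall z, `|z| = 1 ->
      a z = ev P z *m (ev U z *m Dz (fun i => - k i) z) *m dg (ev P z)),
    (forall i j (r : nat), k i + k j < r%:Z -> (U i j)`_r = 0) &
    (forall i j (r : nat), - (k i + k j) < r%:Z -> (V i j)`_r = 0)].
Proof.
move=> hP hQ aE ad.
have hdg (M : 'M[{poly C}]_n) : disk_unit M -> disk_unit (dgp M).
  by move=> h z z1; rewrite ev_dgp dg_unit h // norm_conjC.
have conjV z : `|z| = 1 -> (z^-1)^* = z.
  by move=> z1; rewrite conj_circle ?circle_inv // invrK.
have aE' z : `|z| = 1 ->
    a z = ev (dgp Q) z *m Dz (fun i => - k i) z *m ev (dgp P) z^-1.
  move=> z1; rewrite -ad // aE // !dgM !ev_dgp conjV // conj_circle // mulmxA.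
  congr (_ *m _ *m _); rewrite dg_Dz conj_circle //; congr diag_mx.
  by apply/rowP => i; rewrite !mxE exprz_inv.
have [|U [Uh [QU _ UD]]] := @liouville C n P (dgp P) (dgp Q) Q k (fun i => - k i)
  hP (hdg _ hP); first by move=> z z1; rewrite -aE' // aE.
have [|V [Vh [PV _ VD]]] := @liouville C n (dgp Q) Q P (dgp P) (fun i => - k i) k
  (hdg _ hQ) hQ; first by move=> z z1; rewrite -aE' // aE.
exists U, V; split.
- apply: (mulmxI_det (disk_det0 hP)).
  by rewrite mulmxA -QU -PV mulmx1.
- move=> z z1; rewrite aE' // QU evM ev_dgp conjV //.
  by rewrite -!mulmxA.
- move=> i j r; apply: (@size_laurent _ _ (Uh i j)) => z z1.
  have z0 := circle_neq0 z1.
  have /matrixP/(_ i j) := UD z z1; rewrite mul_Dz mul_mx_Dz !evE.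
  have zz : z ^ (- k j) * z ^ k j = 1 by rewrite -expfzDr // addNr expr0z.
  by move=> E; rewrite -[LHS]mulr1 -zz mulrA E expfzDr //; ring.
move=> i j r; apply: (@size_laurent _ _ (Vh i j)) => z z1.
have z0 := circle_neq0 z1.
have /matrixP/(_ i j) := VD z z1; rewrite mul_Dz mul_mx_Dz !evE.
have zz : z ^ k j * z ^ (- k j) = 1 by rewrite -expfzDr // subrr expr0z.
by move=> E; rewrite -[LHS]mulr1 -zz mulrA E opprD expfzDr //; ring.
Qed.

(** * Hermitian matrices over F *)

(* [b = false] is the case of complex matrices, where [tau] plays no role. *)
Definition tau_fixed (b : bool) (C : numClosedFieldType) n (J M : 'M[C]_n) :=
  b -> tau J M = M.

Section Fixed.
Variables (b : bool) (C : numClosedFieldType) (n : nat) (J : 'M[C]_n).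
Hypothesis HJ : structure_mx J.
Implicit Types M N : 'M[C]_n.
Local Notation isF := (tau_fixed b J).

Lemma tau_fixedM M N : isF M -> isF N -> isF (M *m N).
Proof. by move=> hM hN hb; rewrite tauM // hM // hN. Qed.
Lemma tau_fixedD M N : isF M -> isF N -> isF (M + N).
Proof. by move=> hM hN hb; rewrite tauD hM // hN. Qed.
Lemma tau_fixedB M N : isF M -> isF N -> isF (M - N).
Proof. by move=> hM hN hb; rewrite tauB hM // hN. Qed.
Lemma tau_fixedZ c M : c^* = c -> isF M -> isF (c *: M).
Proof. by move=> hc hM hb; rewrite tauZ hM // hc. Qed.
Lemma tau_fixed_dg M : isF M -> isF (dg M).
Proof. by move=> hM hb; rewrite tau_dg // hM. Qed.
Lemma tau_fixed1 : isF 1%:M.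
Proof. by move=> _; apply: tau1. Qed.
Lemma tau_fixed0 : isF 0.
Proof. by move=> _; rewrite -(scale0r 1%:M) tauZ rmorph0 !scale0r. Qed.
Lemma tau_fixed_sum (I : finType) (X : pred I) (f : I -> 'M[C]_n) :
  (forall i, isF (f i)) -> isF (\sum_(i | X i) f i).
Proof. by move=> h; apply: big_ind => //; [apply: tau_fixed0|apply: tau_fixedD]. Qed.

End Fixed.

(* The [e p] are the diagonal units of F_d inside C_n; the last axiom says that
   hermitian elements of F are real scalars. *)
Record diag_units (b : bool) (C : numClosedFieldType) n (J : 'M[C]_n)
    (I : finType) (e : I -> 'M[C]_n) : Prop := DiagUnits {
  du_id : forall p, e p *m e p = e p;
  du_orth : forall p q, p != q -> e p *m e q = 0;
  du_dg : forall p, dg (e p) = e p;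
  du_sum : \sum_p e p = 1%:M;
  du_neq0 : forall p, e p != 0;
  du_fixed : forall p, tau_fixed b J (e p);
  du_scal : forall p N, dg N = N -> tau_fixed b J N ->
     exists2 r : C, r^* = r & e p *m N *m e p = r *: e p }.

Section Sylvester.
Variables (b : bool) (C : numClosedFieldType) (n : nat) (J : 'M[C]_n).
Variables (I : finType) (e : I -> 'M[C]_n).
Hypothesis HJ : structure_mx J.
Hypothesis He : diag_units b J e.
Implicit Types (M N : 'M[C]_n) (X : {set I}).
Local Notation isF := (tau_fixed b J).

Definition esum X : 'M[C]_n := \sum_(p in X) e p.
Definition esgn X (s : I -> int) : 'M[C]_n := \sum_(p in X) (s p)%:~R *: e p.

Lemma dg_sum (X : pred I) (f : I -> 'M[C]_n) :
  dg (\sum_(i | X i) f i) = \sum_(i | X i) dg (f i).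
Proof. by apply: (big_morph (@dg C n n)); [apply: dgD | apply: dg0]. Qed.

Lemma mul_esum_e X p : esum X *m e p = if p \in X then e p else 0.
Proof.
rewrite mulmx_suml; case: ifPn => pX.
  rewrite (bigD1 p) //= (du_id He) big1 ?addr0 // => q /andP[_ qp].
  exact: du_orth He _ _ qp.
rewrite big1 // => q qX; apply: (du_orth He).
by apply: contraNneq pX => <-.
Qed.

Lemma dg_esum X : dg (esum X) = esum X.
Proof. by rewrite /esum dg_sum; apply: eq_bigr => p _; rewrite (du_dg He). Qed.

Lemma mul_e_esum X p : e p *m esum X = if p \in X then e p else 0.
Proof.
rewrite -[LHS]dgK dgM dg_esum (du_dg He) mul_esum_e.
by case: ifP; rewrite ?(du_dg He) ?dg0.
Qed.

Lemma esum_subl X (Y : {set I}) : Y \subset X -> esum X *m esum Y = esum Y.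
Proof.
move=> /subsetP YX; rewrite {2 3}/esum mulmx_sumr; apply: eq_bigr => p pY.
by rewrite mul_esum_e YX.
Qed.

Lemma esum_subr X (Y : {set I}) : Y \subset X -> esum Y *m esum X = esum Y.
Proof.
move=> /subsetP YX; rewrite {1 3}/esum mulmx_suml; apply: eq_bigr => p pY.
by rewrite mul_e_esum YX.
Qed.

Lemma esum_fixed X : isF (esum X).
Proof. by apply: tau_fixed_sum => p; apply: du_fixed He p. Qed.

Lemma dg_esgn X s : dg (esgn X s) = esgn X s.
Proof.
by rewrite /esgn dg_sum; apply: eq_bigr => p _; rewrite dgZ (du_dg He) rmorph_int.
Qed.

Lemma mul_e_esgn X s p :
  e p *m esgn X s = if p \in X then (s p)%:~R *: e p else 0.
Proof.
rewrite mulmx_sumr; case: ifPn => pX.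
  rewrite (bigD1 p) //= -scalemxAr (du_id He) big1 ?addr0 // => q /andP[_ qp].
  by rewrite -scalemxAr (du_orth He) ?scaler0 // eq_sym.
rewrite big1 // => q qX; rewrite -scalemxAr (du_orth He) ?scaler0 //.
by apply: contraNneq pX => ->.
Qed.

Lemma mul_esgn_e X s p :
  esgn X s *m e p = if p \in X then (s p)%:~R *: e p else 0.
Proof.
rewrite -[LHS]dgK dgM dg_esgn (du_dg He) mul_e_esgn.
by case: ifP; rewrite ?dgZ ?(du_dg He) ?rmorph_int ?dg0.
Qed.

Lemma mul_dg_eq0 N : N *m dg N = 0 -> N = 0.
Proof.
move=> /matrixP h; apply/matrixP => i j; have := h i i; rewrite !mxE.
move/eqP; rewrite psumr_eq0 => [/allP/(_ j (mem_index_enum _))|k _].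
  by rewrite dgE -normCK expf_eq0 normr_eq0 => /eqP.
by rewrite dgE mul_conjC_ge0.
Qed.

(* A congruence [1 + t e_p M], t = 1 or -1, makes a diagonal entry nonzero. *)
Lemma herm_pivot X M : dg M = M -> isF M -> esum X *m M = M -> M != 0 ->
  exists p N M1 r, [/\ p \in X, M = N *m M1 *m dg N, isF N,
     esum X *m N = N *m esum X &
   [/\ dg M1 = M1, isF M1, esum X *m M1 = M1, e p *m M1 *m e p = r *: e p &
     r^* = r /\ r != 0]].
Proof.
move=> hM fM sM M0; have ME : M *m esum X = M.
  by have := congr1 (@dg C n n) sM; rewrite dgM dg_esum hM.
have [p pX pM0] : exists2 p, p \in X & e p *m M != 0.
  have [p /andP[pX pM]|h] := pickP (fun p => (p \in X) && (e p *m M != 0)).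
    by exists p.
  case/eqP: M0; rewrite -sM mulmx_suml big1 // => p pX.
  by have := h p; rewrite pX => /negbFE/eqP.
have [r rr rE] := du_scal He p hM fM.
have fp := du_fixed He p.
have [r0|r0] := eqVneq r 0; last first.
  exists p, 1%:M, M, r; rewrite dg1 mulmx1 mul1mx mulmx1 mul1mx.
  by split=> //; apply: tau_fixed1.
have pMp : e p *m M *m e p = 0 by rewrite rE r0 scale0r.
set Y := e p *m M; have dY : dg Y = M *m e p by rewrite dgM hM (du_dg He).
(* The diagonal entry of [M] at [p] vanishes, so [Y] is nilpotent and [1 + c Y] has inverse
   [1 - c Y]. *)
have YY : Y *m Y = 0 by rewrite /Y mulmxA pMp mul0mx.
have fY : isF Y by apply: tau_fixedM.
have hM2 : dg (M *m M) = M *m M by rewrite dgM hM.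
have fM2 : isF (M *m M) by apply: tau_fixedM.
have [r1 r1r r1E] := du_scal He p hM2 fM2.
have hM3 : dg (M *m M *m M) = M *m M *m M by rewrite dgM hM2 hM mulmxA.
have fM3 : isF (M *m M *m M) by apply: tau_fixedM.
have [r2 r2r r2E] := du_scal He p hM3 fM3.
(* [r1 *: e p] is [Y *m dg Y], which vanishes only if [Y] does. *)
have r10 : r1 != 0.
  apply: contraNneq pM0 => r10; apply/eqP/mul_dg_eq0.
  by rewrite -/Y dY /Y -mulmxA [M *m (M *m _)]mulmxA mulmxA r1E r10 scale0r.
(* [t * r1 *+ 2 + r2] is the diagonal entry after the congruence, as [t * t = 1]. Its values for
   [t = 1] and [t = -1] differ by [4 r1], so they cannot both vanish. *)
have [t t1 tr] : exists2 t : C, t = 1 \/ t = -1 & t * r1 *+ 2 + r2 != 0.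
  have [h|h] := eqVneq (1 * r1 *+ 2 + r2) 0; last by exists 1; [left|].
  exists (-1); [by right|apply: contraNneq r10 => h'].
  have : (1 * r1 *+ 2 + r2) - (- 1 * r1 *+ 2 + r2) = 0 by rewrite h h' subrr.
  have -> : (1 * r1 *+ 2 + r2) - (- 1 * r1 *+ 2 + r2) = 4%:R * r1 by ring.
  by move/eqP; rewrite mulf_eq0 pnatr_eq0.
have tt : t * t = 1 by case: t1 => ->; rewrite ?mulrNN mulr1.
have tC : t^* = t by case: t1 => ->; rewrite ?rmorphN rmorph1.
have tY c d : (1%:M + c *: Y) *m (1%:M + d *: Y) = 1%:M + (c + d) *: Y.
  rewrite mulmxDl mul1mx mulmxDr mulmx1 -scalemxAl -scalemxAr YY !scaler0 addr0.
  by rewrite -addrA -scalerDl [d + c]addrC.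
set N := 1%:M + (- t) *: Y; set N' := 1%:M + t *: Y.
have NN' : N *m N' = 1%:M by rewrite tY addNr scale0r addr0.
have fN c : c^* = c -> isF (1%:M + c *: Y).
  by move=> cc; apply: tau_fixedD; [apply: tau_fixed1|apply: tau_fixedZ].
have fN' : isF N' by apply: fN.
have EY : esum X *m Y = Y by rewrite /Y mulmxA mul_esum_e pX.
have YE : Y *m esum X = Y by rewrite /Y -mulmxA ME.
exists p, N, (N' *m M *m dg N'), (t * r1 *+ 2 + r2); split => //.
- by rewrite !mulmxA NN' mul1mx -mulmxA -dgM NN' dg1 mulmx1.
- by apply: fN; rewrite rmorphN /= tC.
- by rewrite /N mulmxDr mulmxDl mulmx1 mul1mx -scalemxAr -scalemxAl EY YE.
split=> //.
- by rewrite !dgM dgK hM mulmxA.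
- by apply: tau_fixedM => //; [apply: tau_fixedM|apply: tau_fixed_dg].
- rewrite !mulmxA; congr (_ *m _).
  by rewrite /N' mulmxDr mulmx1 -scalemxAr EY !mulmxDl sM mul1mx.
- have eN : e p *m N' = e p + t *: Y.
    by rewrite /N' mulmxDr mulmx1 -scalemxAr /Y mulmxA (du_id He).
  have Ne : dg N' *m e p = e p + t *: (M *m e p).
    by rewrite -[LHS]dgK dgM dgK (du_dg He) eN dgD dgZ tC (du_dg He) dY.
  have -> : e p *m (N' *m M *m dg N') *m e p =
      (e p *m N') *m M *m (dg N' *m e p) by rewrite !mulmxA.
  rewrite !mulmxA in r1E r2E.
  rewrite eN Ne mulmxDl mulmxDr mulmxDl -!scalemxAl mulmxDl -scalemxAr pMp.
  rewrite -!scalemxAl -!scalemxAr scalerA tt scale1r /Y !mulmxA r1E r2E add0r.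
  by rewrite !scalerA -!scalerDl addrA mulr2n.
- by rewrite rmorphD rmorphMn rmorphM /= r1r r2r tC.
Qed.

(** Induction on the size of [X], splitting off one pivot at a time. The matrix [M] may be
    degenerate, whence the value 0 for [s] and no invertibility claim on [B]; both are settled where
    [M] is known to be invertible on its block. *)
Lemma herm_congr X M : dg M = M -> isF M -> esum X *m M = M ->
  exists B s, [/\ isF B, esum X *m B *m esum X = B,
    forall p, [\/ s p = 0, s p = 1 | s p = -1] & M = B *m esgn X s *m dg B].
Proof.
have [m] := ubnP #|X|; elim: m X M => // m IHm X M Xm hM fM sM.
have [->|M0] := eqVneq M 0.
  exists 0, (fun=> 0); split; first exact: tau_fixed0.
  - by rewrite mulmx0 mul0mx.
  - by move=> p; apply: Or31.
  - by rewrite !mul0mx.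
have [p [N [M1 [r [pX -> fN EN [hM1 fM1 sM1 rE [rr r0]]]]]]] :=
  herm_pivot hM fM sM M0.
have fp := du_fixed He p.
have M1E : M1 *m esum X = M1.
  by have := congr1 (@dg C n n) sM1; rewrite dgM dg_esum hM1.
(* Schur complement of the pivot: it is annihilated by [e p] and so lives on [X :\ p]. *)
pose M2 := M1 - r^-1 *: (M1 *m e p *m M1).
have rV : (r^-1)^* = r^-1 by rewrite fmorphV /= rr.
have hM2 : dg M2 = M2 by rewrite dgB dgZ !dgM (du_dg He) hM1 rV mulmxA.
have fM2 : isF M2.
  by apply: tau_fixedB => //; apply: tau_fixedZ => //; do 2!apply: tau_fixedM => //.
have eM2 : e p *m M2 = 0.
  by rewrite mulmxBr -scalemxAr !mulmxA rE -scalemxAl scalerA mulVf // scale1r subrr.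
have EX : esum X = e p + esum (X :\ p).
  by rewrite /esum (big_setD1 p).
have sM2 : esum (X :\ p) *m M2 = M2.
  have : esum X *m M2 = M2 by rewrite mulmxBr -scalemxAr !mulmxA sM1.
  by rewrite EX mulmxDl eM2 add0r.
have Xpm : (#|X :\ p| < m)%N by move: Xm; rewrite (cardsD1 p X) pX.
have [B2 [s2 [fB2 sB2 s2P M2E]]] := IHm _ _ Xpm hM2 fM2 sM2.
pose sg : int := if 0 < r then 1 else -1.
pose l := (sqrtC `|r|)^-1.
have l0 : 0 <= l by rewrite invr_ge0 sqrtC_ge0.
have lC : l^* = l by apply/CrealP/ger0_real.
have rreal : r \is Num.real by apply/CrealP.
have sgl : sg%:~R * (l * l) = r^-1.
  rewrite -invfM -expr2 sqrtCK /sg; case: ifPn => [/gtr0_norm->|]; first by rewrite mul1r.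
  rewrite -real_leNgt ?real0 // => rle0; rewrite ler0_norm //.
  by rewrite rmorphN mulN1r invrN opprK.
have X'p : esum (X :\ p) *m e p = 0 by rewrite mul_esum_e setD11.
have pX' : e p *m esum (X :\ p) = 0 by rewrite mul_e_esum setD11.
have B2p : B2 *m e p = 0 by rewrite -sB2 -mulmxA X'p mulmx0.
have pB2 : e p *m dg B2 = 0.
  by rewrite -[LHS]dgK dgM dgK (du_dg He) B2p dg0.
pose s q := if q == p then sg else s2 q.
have SE : esgn X s = sg%:~R *: e p + esgn (X :\ p) s2.
  rewrite /esgn (big_setD1 p) //= /s eqxx; congr (_ + _).
  by apply: eq_bigr => q; rewrite !inE => /andP[/negPf->].
have pS : e p *m esgn (X :\ p) s2 = 0 by rewrite mul_e_esgn setD11.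
have Sp : esgn (X :\ p) s2 *m e p = 0 by rewrite mul_esgn_e setD11.
(* The first term contributes [sg * l ^ 2 = r^-1] times [M1 *m e p *m M1], exactly what was
   subtracted in [M2]; the cross terms vanish because [B2] lives on [X :\ p]. *)
pose B0 := l *: (M1 *m e p) + B2.
have sB0 : esum X *m B0 *m esum X = B0.
  rewrite /B0 mulmxDr -scalemxAr mulmxA sM1 mulmxDl -scalemxAl.
  rewrite -[M1 *m e p *m _]mulmxA.
  rewrite mul_e_esum pX; congr (_ + _).
  have X'X : X :\ p \subset X by apply: subD1set.
  by rewrite -sB2 !mulmxA esum_subl // -!mulmxA esum_subr.
exists (N *m B0), s; split.
- by apply: tau_fixedM => //; apply: tau_fixedD => //; apply: tau_fixedZ => //; apply: tau_fixedM.
- by rewrite mulmxA EN -!mulmxA; congr (_ *m _); rewrite mulmxA.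
- move=> q; rewrite /s; case: eqP => // _; rewrite /sg.
  by case: ifP => _; [apply: Or32|apply: Or33].
rewrite dgM !mulmxA; congr (_ *m _); rewrite -!mulmxA; congr (_ *m _).
have -> : dg B0 = l *: (e p *m M1) + dg B2.
  by rewrite dgD dgZ lC dgM hM1 (du_dg He).
have M1E' : M1 = r^-1 *: (M1 *m e p *m M1) + M2 by rewrite addrC subrK.
set S2 := esgn (X :\ p) s2 in pS Sp SE M2E.
have -> : B0 *m (esgn X s *m (l *: (e p *m M1) + dg B2)) =
    (B0 *m esgn X s) *m (l *: (e p *m M1) + dg B2) by rewrite mulmxA.
have -> : B0 *m esgn X s = (sg%:~R * l) *: (M1 *m e p) + B2 *m S2.
  rewrite SE /B0 mulmxDl !mulmxDr -!scalemxAl -!scalemxAr -!mulmxA (du_id He).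
  by rewrite pS B2p mulmx0 !scaler0 addr0 add0r scalerA mulrC.
rewrite mulmxDl !mulmxDr -!scalemxAl -!scalemxAr -!mulmxA.
rewrite [e p *m (e p *m _)]mulmxA (du_id He) pB2 [S2 *m (e p *m _)]mulmxA Sp.
rewrite !(mulmx0, mul0mx) !scaler0 addr0 add0r scalerA -mulrA sgl.
by rewrite !mulmxA -M2E {1}M1E'.
Qed.
End Sylvester.

(** * The block congruence *)

Section Blocks.
Variables (C : numClosedFieldType) (n : nat).
Variables (Ep E0 Em Pr D D' u T B S W M0 : 'M[C]_n).
Hypothesis EpEp : Ep *m Ep = Ep.
Hypothesis E0E0 : E0 *m E0 = E0.
Hypothesis EpE0 : Ep *m E0 = 0.
Hypothesis E0Ep : E0 *m Ep = 0.
Hypothesis EpEm : Ep *m Em = 0.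
Hypothesis E0Em : E0 *m Em = 0.
Hypothesis EmE0 : Em *m E0 = 0.
Hypothesis E1 : Ep + E0 + Em = 1%:M.
Hypothesis PrPr : Pr *m Pr = 1%:M.
Hypothesis PrEp : Pr *m Ep = Em *m Pr.
Hypothesis PrEm : Pr *m Em = Ep *m Pr.
Hypothesis PrE0 : Pr *m E0 = E0 *m Pr.
Hypothesis u00 : E0 *m u *m E0 = M0.
Hypothesis um0 : Em *m u *m E0 = 0.
Hypothesis u0m : E0 *m u *m Em = 0.
Hypothesis umm : Em *m u *m Em = 0.
Hypothesis BE0 : B *m E0 = B.
Hypothesis E0B : E0 *m B = B.
Hypothesis TEp : T *m Ep = T.
Hypothesis EpT : Ep *m T = T.

(** All matrices here are values at one point [z]: [D] is the diagonal of powers, [D'] its inverse,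
    [u] the value of [U], and [h = u *m D'] is to be reduced. By columns: the identity on [Ep]; on
    [E0], [B] diagonalizes the middle block [M0] and [Ep *m u *m W] eliminates its neighbours; on
    [Em], [Em *m u *m Ep] produces the corner blocks of [h] and [T] absorbs half of the positive
    block. The powers occur only as [D *m Ep], which is polynomial in [z]. *)
Definition gauge : 'M[C]_n :=
  Ep + (E0 + Ep *m u *m W) *m B + (T *m (D *m Ep) + Em *m u *m Ep) *m Pr.

Let BEp : B *m Ep = 0. Proof. by rewrite -BE0 -mulmxA E0Ep mulmx0. Qed.
Let BEm : B *m Em = 0. Proof. by rewrite -BE0 -mulmxA E0Em mulmx0. Qed.

Let gaugeE : gauge =
  Ep + (E0 + Ep *m u *m W) *m B + (T *m D + Em *m u) *m Ep *m Pr.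
Proof. by rewrite /gauge; congr (_ + _ *m _); rewrite mulmxDl mulmxA. Qed.

Let gauge_p : gauge *m Ep = Ep.
Proof.
rewrite gaugeE !mulmxDl EpEp -!mulmxA BEp PrEp [Ep *m (Em *m _)]mulmxA EpEm.
by rewrite !mulmxA !mulmx0 !mul0mx !addr0.
Qed.

Let gauge_0 : gauge *m E0 = (E0 + Ep *m u *m W) *m B.
Proof.
rewrite gaugeE (mulmxDl (Ep + _)) (mulmxDl Ep) EpE0 add0r -[_ *m B *m E0]mulmxA BE0.
by rewrite -[_ *m Pr *m E0]mulmxA PrE0 mulmxA -[_ *m Ep *m E0]mulmxA EpE0
  mulmx0 mul0mx addr0.
Qed.

Let gauge_m : gauge *m Em = (T *m D + Em *m u) *m Ep *m Pr.
Proof.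
rewrite gaugeE (mulmxDl (Ep + _)) (mulmxDl Ep) EpEm add0r -[_ *m B *m Em]mulmxA BEm mulmx0 add0r.
by rewrite -[_ *m Pr *m Em]mulmxA PrEm mulmxA -[_ *m Ep *m Ep]mulmxA EpEp.
Qed.

(** Proved before the hypotheses on [D'] are made, since it is applied at [z = 0] as well. A row
    vector killed by [gauge] is killed on [Ep], then on [E0] by invertibility of [B] there, then on
    [Em], because the rows of [u] in [Em] are supported on [Ep] and [u] is invertible. *)
Lemma gauge_unit : u \in unitmx -> B + (Ep + Em) \in unitmx -> gauge \in unitmx.
Proof.
move=> uu uB; rewrite -row_free_unit; apply: inj_row_free => v vG.
have vp : v *m Ep = 0 by rewrite -gauge_p mulmxA vG mul0mx.
have v0 : v *m E0 = 0.
  have : v *m E0 *m (B + (Ep + Em)) = 0.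
    have : v *m (gauge *m E0) = 0 by rewrite mulmxA vG mul0mx.
    rewrite gauge_0 mulmxDl mulmxDr E0B !mulmxA vp !mul0mx addr0 => vB.
    by rewrite !mulmxDr -!mulmxA E0B E0Ep E0Em !mulmx0 !addr0.
  by move/(congr1 (mulmx^~ (invmx (B + (Ep + Em))))); rewrite mulmxK // mul0mx.
have vm : v *m Em = 0.
  have : v *m Em *m u = 0.
    have : v *m (gauge *m Em) *m Pr = 0 by rewrite mulmxA vG !mul0mx.
    rewrite gauge_m mulmxA -mulmxA PrPr mulmx1 mulmxDl mulmxDr !mulmxA.
    rewrite -{1}EpT mulmxA vp !mul0mx add0r => vuE.
    have -> : v *m Em *m u = v *m (Em *m u *m Ep) + v *m (Em *m u *m E0) +
        v *m (Em *m u *m Em) by rewrite -mulmxDr -mulmxDr -mulmxDr -mulmxDr E1 mulmx1 mulmxA.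
    by rewrite um0 umm !mulmx0 !addr0 !mulmxA.
  by move/(congr1 (mulmx^~ (invmx u))); rewrite mulmxK // mul0mx.
by rewrite -[v]mulmx1 -E1 !mulmxDr vp v0 vm !addr0.
Qed.

Hypothesis DD' : D *m D' = 1%:M.
Hypothesis EpD : Ep *m D = D *m Ep.
Hypothesis EpD' : Ep *m D' = D' *m Ep.
Hypothesis EmD' : Em *m D' = D' *m Em.
Hypothesis E0D' : E0 *m D' = E0.
Hypothesis D'E0 : D' *m E0 = E0.
Hypothesis dgEp : dg Ep = Ep.
Hypothesis dgE0 : dg E0 = E0.
Hypothesis dgEm : dg Em = Em.
Hypothesis dgPr : dg Pr = Pr.
Hypothesis dg_D : dg D = D'.
Hypothesis dgh : dg (u *m D') = u *m D'.
Hypothesis MW : M0 *m W = E0.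
Hypothesis WM : W *m M0 = E0.
Hypothesis WE0 : W *m E0 = W.
Hypothesis E0W : E0 *m W = W.
Hypothesis dgW : dg W = W.
Hypothesis BS : B *m S *m dg B = M0.
Hypothesis E0S : E0 *m S = S.
Hypothesis SE0 : S *m E0 = S.
Hypothesis Tspec : T + dg T = Ep *m ((u - u *m W *m u) *m D') *m Ep.

Let h := u *m D'.
Let L := E0 + Ep *m u *m W.

Let gauge_D : gauge *m (Ep *m D *m Pr + Pr *m D' *m Ep + S) =
  Ep *m D *m Pr + (T + Em *m h) *m Ep + L *m B *m S.
Proof.
rewrite 2!mulmxDr; congr (_ + _ + _).
- by rewrite !mulmxA gauge_p.
- have -> : Pr *m D' *m Ep = Em *m Pr *m D' *m Ep.
    by rewrite -PrEp -!mulmxA -[in RHS]EpD' [Ep *m (Ep *m _)]mulmxA EpEp EpD'.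
  rewrite !mulmxA gauge_m -!mulmxA [Pr *m (Pr *m _)]mulmxA PrPr mul1mx.
  rewrite [Ep *m (D' *m Ep)]mulmxA EpD' -mulmxA EpEp mulmxA; congr (_ *m _).
  by rewrite mulmxDl -!mulmxA DD' mulmx1.
- by rewrite -{1}E0S mulmxA gauge_0.
Qed.

(** Block by block: [h] vanishes at [(-,-)], [(-,0)] and [(0,-)], and equals [M0] at [(0,0)].
    Eliminating the blocks next to [M0] adds [u *m W *m h] at [(+,+)], which is why [Tspec] splits
    the Schur complement and not the block of [h] itself. *)
Lemma gauge_congr :
  gauge *m (Ep *m D *m Pr + Pr *m D' *m Ep + S) *m dg gauge = u *m D'.
Proof.
have [g gE] : exists g, g = u *m D' by exists (u *m D').
have dgu : D *m dg u = g by rewrite gE -[D]dgK dg_D -dgM.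
have dBE0 : E0 *m dg B = dg B by rewrite -{2}BE0 dgM dgE0.
have EpdB : Ep *m dg B = 0 by rewrite -dBE0 mulmxA EpE0 mul0mx.
have EmdB : Em *m dg B = 0 by rewrite -dBE0 mulmxA EmE0 mul0mx.
have dTEp : Ep *m dg T = dg T by rewrite -{2}TEp dgM dgEp.
have EpG : Ep *m dg gauge = Ep.
  by rewrite -[LHS]dgK dgM dgK dgEp gauge_p dgEp.
have PrG : Ep *m D *m Pr *m dg gauge = dg T + Ep *m g *m Em.
  have -> : Ep *m D *m Pr = Ep *m D *m Pr *m Em.
    by rewrite -[RHS]mulmxA PrEm mulmxA -[Ep *m D *m Ep]mulmxA -EpD mulmxA EpEp.
  have EmG : Em *m dg gauge = Pr *m (Ep *m (D' *m dg T + dg u *m Em)).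
    by rewrite -[LHS]dgK dgM dgK dgEm gauge_m !dgM dgPr dgEp !dgD !dgM dg_D dgEm.
  rewrite -mulmxA EmG -[_ *m Pr *m _]mulmxA [Pr *m _]mulmxA PrPr mul1mx.
  rewrite mulmxA -[Ep *m D *m Ep]mulmxA -EpD mulmxA EpEp mulmxDr.
  rewrite -!mulmxA [D *m (D' *m _)]mulmxA DD' mul1mx dTEp.
  by rewrite [D *m (dg u *m _)]mulmxA dgu !mulmxA.
have E0G : E0 *m dg gauge = dg B *m dg L.
  by rewrite -[LHS]dgK dgM dgK dgE0 gauge_0 dgM.
have SG : L *m B *m S *m dg gauge = L *m M0 *m dg L.
  rewrite -[L *m B *m S *m _]mulmxA -{1}SE0 -[S *m E0 *m _]mulmxA E0G -BS.
  by rewrite !mulmxA.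
have dL : dg L = E0 + W *m dg u *m Ep.
  by rewrite /L dgD !dgM dgE0 dgW dgEp mulmxA.
have LM : L *m M0 = M0 + Ep *m u *m E0.
  have E0M0 : E0 *m M0 = M0 by rewrite -u00 !mulmxA E0E0.
  by rewrite /L mulmxDl E0M0 -[_ *m W *m M0]mulmxA WM.
have DE0 : E0 *m D = E0 by rewrite -[LHS]dgK dgM dg_D dgE0 D'E0 dgE0.
have Wdu : W *m dg u = W *m g.
  by rewrite -{1}WE0 -DE0 -!mulmxA dgu mulmxA WE0.
have uE0 : u *m E0 = g *m E0 by rewrite gE -mulmxA D'E0.
have E0u0 : E0 *m dg u *m Ep = E0 *m g *m Ep by rewrite -{1}DE0 -[E0 *m D *m _]mulmxA dgu.
have hmm : Em *m g *m Em = 0.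
  by rewrite gE -!mulmxA -EmD' [u *m (Em *m _)]mulmxA [Em *m (_ *m D')]mulmxA !mulmxA umm mul0mx.
have hm0 : Em *m g *m E0 = 0 by rewrite -mulmxA -uE0 mulmxA um0.
have h0m : E0 *m g *m Em = 0.
  by rewrite gE -!mulmxA -EmD' [u *m (Em *m _)]mulmxA [E0 *m (_ *m D')]mulmxA !mulmxA u0m mul0mx.
have h00 : E0 *m g *m E0 = M0 by rewrite -mulmxA -uE0 mulmxA u00.
rewrite gauge_D (mulmxDl (Ep *m D *m Pr + _)) (mulmxDl (Ep *m D *m Pr)) PrG SG LM dL.
rewrite -[_ *m Ep *m dg gauge]mulmxA EpG (mulmxDl T) TEp /h -!gE.
have -> : (M0 + Ep *m u *m E0) *m (E0 + W *m dg u *m Ep) =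
   E0 *m g *m E0 + E0 *m g *m Ep + Ep *m g *m E0 + Ep *m u *m W *m g *m Ep.
  rewrite mulmxDl !mulmxDr -h00.
  have -> : E0 *m g *m E0 *m E0 = E0 *m g *m E0 by rewrite -mulmxA E0E0.
  have -> : Ep *m u *m E0 *m E0 = Ep *m g *m E0 by rewrite -!mulmxA E0E0 uE0.
  have -> : E0 *m g *m E0 *m (W *m dg u *m Ep) = E0 *m g *m Ep.
    by rewrite h00 !mulmxA MW E0u0.
  have -> : Ep *m u *m E0 *m (W *m dg u *m Ep) = Ep *m u *m W *m dg u *m Ep.
    by rewrite -[_ *m E0 *m _]mulmxA [E0 *m _]mulmxA [E0 *m (_ *m _)]mulmxA E0W !mulmxA.
  by rewrite -[_ *m W *m dg u]mulmxA Wdu !mulmxA !addrA.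
have hE : g = Ep *m g *m Ep + Ep *m g *m E0 + Ep *m g *m Em +
    (E0 *m g *m Ep + E0 *m g *m E0) + Em *m g *m Ep.
  rewrite -[g in LHS]mulmx1 -[g in LHS]mul1mx -E1 !mulmxDl !mulmxDr.
  by rewrite hmm hm0 h0m !addr0.
have TT : T + dg T = Ep *m g *m Ep - Ep *m u *m W *m g *m Ep.
  rewrite Tspec mulmxBl mulmxBr mulmxBl; by congr (_ - _); rewrite gE !mulmxA.
have PP : Ep *m g *m Ep = T + dg T + Ep *m u *m W *m g *m Ep by rewrite TT subrK.
rewrite [RHS]hE PP.
by rewrite [LHS](AC (2*2*4) (3*1*8*7*2*(6*5)*4)).
Qed.

End Blocks.

(** * Splitting a hermitian Laurent matrix into a polynomial and its dagger *)

Section Splitting.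
Variables (b : bool) (C : numClosedFieldType) (n : nat) (J : 'M[C]_n).
Hypothesis HJ : structure_mx J.

Lemma scalar_split (p : {poly C}) (k : int) :
  exists t : {poly C} * {poly C}, forall z, `|z| = 1 ->
    p.[z] * z ^ k = t.1.[z] + t.2.[z^-1].
Proof.
case: k => m; first by exists (p * 'X^m, 0) => z _; rewrite !hornerE.
exists (drop_poly m.+1 p, revp m.+1 (take_poly m.+1 p)) => z z1 /=.
have z0 := circle_neq0 z1; rewrite -{1}(poly_take_drop m.+1 p).
rewrite horner_revp ?invr_neq0 //; last by rewrite (leq_trans (size_take_poly _ _)).
rewrite invrK NegzE -exprnN hornerD hornerM hornerXn mulrDl exprVn.
by rewrite addrC mulfK ?expf_neq0 // mulrC.
Qed.

Lemma laurent_split (U : 'M[{poly C}]_n) (k : 'I_n -> int) :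
  exists T T' : 'M[{poly C}]_n, forall z, `|z| = 1 ->
    ev U z *m Dz k z = ev T z + ev T' z^-1.
Proof.
have /fin_all_exists[t tP] : forall ij : 'I_n * 'I_n, exists t : {poly C} * {poly C},
    forall z, `|z| = 1 -> (U ij.1 ij.2).[z] * z ^ k ij.2 = t.1.[z] + t.2.[z^-1].
  by move=> ij; apply: scalar_split.
exists (\matrix_(i, j) (t (i, j)).1), (\matrix_(i, j) (t (i, j)).2) => z z1.
apply/matrixP => i j; rewrite mul_mx_Dz evE (tP (i, j)) //.
by rewrite [RHS]mxE !evE !mxE.
Qed.

(** On the circle [T - dg T'] is hermitian and polynomial in [z], hence constant; taking half of
    this constant away from [T] makes the two parts daggers of each other. Averaging with the image
    under [tau] then keeps the sum, because [f] is invariant. *)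
Lemma herm_split (f : C -> 'M[C]_n) (T T' : 'M[{poly C}]_n) :
  (forall z, `|z| = 1 -> f z = ev T z + ev T' z^-1) ->
  (forall z, `|z| = 1 -> dg (f z) = f z) ->
  (b -> forall z, `|z| = 1 -> tau J (f z^*) = f z) ->
  exists T2 : 'M[{poly C}]_n, (b -> taup J T2 = T2) /\
    forall z, `|z| = 1 -> f z = ev T2 z + dg (ev T2 z).
Proof.
have half : 2^-1 + 2^-1 = 1 :> C by rewrite -mulr2n -[_ *+ 2]mulr_natl divff ?pnatr_eq0.
move=> fE fh ft; pose X := T - dgp T'.
have XE z : `|z| = 1 -> ev X z = ev T z - dg (ev T' z^-1).
  by move=> z1; rewrite evB ev_dgp conj_circle.
have Xh z : `|z| = 1 -> dg (ev X z) = ev X z.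
  move=> z1; have := fh z z1; rewrite XE // fE // dgD dgB dgK => E.
  by apply/eqP; rewrite subr_eq addrAC -E addrK.
have Xc i j : X i j = ((X i j).[0])%:P.
  apply: (@laurent_const _ _ (dgp X i j)) => z z1.
  have /matrixP/(_ i j) := Xh z z1; rewrite evE => <-.
  by rewrite -evE ev_dgp conj_circle ?circle_inv // invrK.
have evX z : ev X z = ev X 0.
  by apply/matrixP => i j; rewrite !evE Xc !hornerC.
have X0h : dg (ev X 0) = ev X 0 by rewrite -(evX 1) Xh ?normr1.
pose T1 := T - const_pmx (2^-1 *: ev X 0).
have T1E z : `|z| = 1 -> f z = ev T1 z + dg (ev T1 z).
  move=> z1; rewrite /T1 evB ev_const dgB dgZ X0h fmorphV /= rmorph_nat.
  rewrite addrACA -opprD -scalerDl half.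
  have TX : ev T' z^-1 = dg (ev T z) - ev X 0.
    by rewrite -(evX z) -Xh // XE // dgB dgK opprB addrC subrK.
  by rewrite scale1r fE // TX addrA.
clearbody T1; case: b ft => [ft|_]; last by exists T1.
exists (const_pmx (2^-1%:M) *m (T1 + taup J T1)); split.
  move=> _; apply: ev_inj => z z1.
  rewrite ev_taup !evM !ev_const !mul_scalar_mx tauZ fmorphV /= rmorph_nat.
  by rewrite !evD !ev_taup tauD // tauK // conjCK addrC.
move=> z z1; rewrite evM ev_const mul_scalar_mx evD ev_taup dgZ fmorphV /= rmorph_nat.
rewrite -scalerDr dgD addrACA -T1E // -tau_dg // -tauD // -T1E ?circle_conj // ft //.
by rewrite scalerDr -scalerDl half scale1r.
Qed.

End Splitting.

Lemma horner_const (C : numClosedFieldType) (p : {poly C}) (z w : C) :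
  (forall r : nat, (0 < r)%N -> p`_r = 0) -> p.[z] = p.[w].
Proof.
move=> h; have -> : p = (p`_0)%:P.
  by apply/polyP => -[|r]; rewrite coefC //= h.
by rewrite !hornerC.
Qed.

(** * Reduction of the hermitian middle factor to the model *)

Section Reduction.
Variables (b : bool) (C : numClosedFieldType) (n : nat) (J : 'M[C]_n).
Variables (I : finType) (blk : 'I_n -> I) (K : I -> int) (rv : I -> I).
Variable (Pr : 'M[C]_n).
Let e (p : I) : 'M[C]_n := diag_mx (\row_i (blk i == p)%:R).
Let k (i : 'I_n) := K (blk i).
Hypothesis HJ : structure_mx J.
Hypothesis He : diag_units b J e.
Hypothesis PrPr : Pr *m Pr = 1%:M.
Hypothesis dgPr : dg Pr = Pr.
Hypothesis fPr : tau_fixed b J Pr.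
Hypothesis Pre : forall p, Pr *m e p = e (rv p) *m Pr.
Hypothesis rvK : involutive rv.
Hypothesis Krv : forall p, K (rv p) = - K p.
Local Notation isF := (tau_fixed b J).

Lemma esum_mul (X : {set I}) (M : 'M[C]_n) i j :
  (esum e X *m M) i j = (blk i \in X)%:R * M i j.
Proof.
rewrite /esum mulmx_suml summxE; under eq_bigr do rewrite mul_diag_mx mxE mxE.
have [iX|iX] := boolP (blk i \in X).
  rewrite (bigD1 (blk i)) //= eqxx big1 ?addr0 // => p /andP[_ /negPf].
  by rewrite eq_sym => ->; rewrite mul0r.
rewrite mul0r big1 // => p pX; case: eqP => [bp|_]; last by rewrite mul0r.
by rewrite bp pX in iX.
Qed.

Lemma mul_esum (X : {set I}) (M : 'M[C]_n) i j :
  (M *m esum e X) i j = M i j * (blk j \in X)%:R.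
Proof.
have -> : M *m esum e X = (esum e X *m M^T)^T.
  rewrite trmx_mul trmxK; congr (_ *m _); rewrite /esum raddf_sum /=.
  by apply: eq_bigr => p _; rewrite tr_diag_mx.
by rewrite mxE esum_mul mxE mulrC.
Qed.

Lemma Dz_sum (L : I -> int) z :
  Dz (fun i => L (blk i)) z = \sum_p z ^ L p *: e p :> 'M[C]_n.
Proof.
apply/matrixP => i j; rewrite summxE (bigD1 (blk i)) //= big1 => [|p /negPf bp].
  by rewrite !mxE eqxx addr0; case: eqP => _; rewrite ?mulr1 ?mulr0.
by rewrite !mxE eq_sym bp mul0rn mulr0.
Qed.

Lemma tau_Dz (L : I -> int) z :
  b -> tau J (Dz (fun i => L (blk i)) z^*) = Dz (fun i => L (blk i)) z.
Proof.
move=> hb; rewrite !Dz_sum.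
rewrite (big_morph (tau J) (tauD J) (@tau_fixed0 true C n J isT)).
apply: eq_bigr => p _; rewrite tauZ fmorphXz /= conjCK.
by rewrite (du_fixed He).
Qed.

Let Xp := [set p | 0 < K p].
Let X0 := [set p | K p == 0].
Let Xm := [set p | K p < 0].

Lemma esum_disj (X Y : {set I}) : [disjoint X & Y] -> esum e X *m esum e Y = 0.
Proof.
move=> /pred0P XY; apply/matrixP => i j; rewrite esum_mul.
rewrite -[esum e Y]mul1mx mul_esum !mxE.
case: eqP => [->|_]; last by rewrite mul0r mulr0.
have /= := XY (blk j); case: (_ \in X); case: (_ \in Y) => //= _;
  by rewrite ?mul0r ?mulr0.
Qed.

(** The sign [m] is 1 for [U] and -1 for its inverse [V], so that one statement serves both degree
    bounds. *)
Lemma ev_block0 (U : 'M[{poly C}]_n) (X Y : {set I}) (m : int) z :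
  (forall i j (r : nat), m * (k i + k j) < r%:Z -> (U i j)`_r = 0) ->
  (forall p q, p \in X -> q \in Y -> m * (K p + K q) < 0) ->
  esum e X *m ev U z *m esum e Y = 0.
Proof.
move=> hU h; apply/matrixP => i j; rewrite mul_esum esum_mul evE mxE.
have [iX|] := boolP (blk i \in X); last by rewrite !mul0r.
have [jY|] := boolP (blk j \in Y); last by rewrite mulr0.
suff -> : U i j = 0 by rewrite horner0 mulr0 mul0r.
by apply/polyP => r; rewrite coef0 hU // (lt_le_trans (h _ _ iX jY)).
Qed.

Lemma ev_block_const (U : 'M[{poly C}]_n) (m : int) z :
  (forall i j (r : nat), m * (k i + k j) < r%:Z -> (U i j)`_r = 0) ->
  esum e X0 *m ev U z *m esum e X0 = esum e X0 *m ev U 0 *m esum e X0.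
Proof.
move=> hU; apply/matrixP => i j; rewrite !mul_esum !esum_mul !evE.
have [iX|] := boolP (blk i \in X0); last by rewrite !mul0r.
have [jY|] := boolP (blk j \in X0); last by rewrite !mulr0.
rewrite (@horner_const _ _ z 0) // => r r0; apply: hU.
by move: iX jY; rewrite !inE /k => /eqP -> /eqP ->; rewrite addr0 mulr0.
Qed.

Lemma esum_parts : esum e Xp + esum e X0 + esum e Xm = 1%:M :> 'M[C]_n.
Proof.
apply/matrixP => i j; rewrite !mxE.
have E X : esum e X i j = (blk i \in X)%:R * (i == j)%:R :> C.
  by rewrite -[esum e X]mulmx1 esum_mul mxE.
rewrite !E -!mulrDl -!natrD !inE.
by case: ltrgtP => _; rewrite ?mul1r.
Qed.

Lemma Pr_esum (X : {set I}) : Pr *m esum e X = esum e (rv @^-1: X) *m Pr.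
Proof.
rewrite /esum mulmx_sumr mulmx_suml (reindex_inj (inv_inj rvK)) /=.
apply: eq_big => p; first by rewrite inE.
by move=> _; rewrite Pre rvK.
Qed.

Lemma Pr_Xp : Pr *m esum e Xp = esum e Xm *m Pr.
Proof.
by rewrite Pr_esum; congr (esum e _ *m _); apply/setP => p; rewrite !inE Krv oppr_gt0.
Qed.
Lemma Pr_Xm : Pr *m esum e Xm = esum e Xp *m Pr.
Proof.
by rewrite Pr_esum; congr (esum e _ *m _); apply/setP => p; rewrite !inE Krv oppr_lt0.
Qed.
Lemma Pr_X0 : Pr *m esum e X0 = esum e X0 *m Pr.
Proof.
by rewrite Pr_esum; congr (esum e _ *m _); apply/setP => p; rewrite !inE Krv oppr_eq0.
Qed.

Lemma esum_Dz (X : {set I}) (l : 'I_n -> int) (z : C) :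
  esum e X *m Dz l z = Dz l z *m esum e X.
Proof.
apply/matrixP => i j; rewrite esum_mul mul_esum !mxE.
by case: eqP => [->|_]; rewrite ?mulr0n ?mulr0 ?mul0r // mulrC.
Qed.

Lemma Dz_X0 (l : 'I_n -> int) (z : C) : (forall i, k i = 0 -> l i = 0) ->
  Dz l z *m esum e X0 = esum e X0.
Proof.
move=> lk; apply/matrixP => i j; rewrite mul_Dz -[esum e X0]mulmx1 esum_mul inE.
by case: eqP => [/lk ->|_]; rewrite ?mul0r ?mulr0 // expr0z mul1r.
Qed.

Let Dp : 'M[{poly C}]_n := diag_mx (\row_i if 0 < k i then 'X^(absz (k i)) else 0).

Lemma ev_Dp z : ev Dp z = Dz k z *m esum e Xp.
Proof.
apply/matrixP => i j; rewrite evE mul_Dz -[esum e Xp]mulmx1 esum_mul !mxE inE -/(k i).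
case: eqP => _; last by rewrite mulr0n horner0 !mulr0.
rewrite mulr1n mulr1; case: ifPn => ki; last by rewrite horner0 mulr0.
by rewrite hornerXn mulr1 exprnP gtz0_abs.
Qed.

Lemma esum_orth : [/\ esum e Xp *m esum e X0 = 0,
  esum e Xp *m esum e Xm = 0 & esum e X0 *m esum e Xm = 0].
Proof.
have disj (X Y : pred int) : (forall x, X x -> ~~ Y x) ->
    [disjoint [set p | X (K p)] & [set p | Y (K p)]].
  move=> XY; apply/pred0P => p /=; rewrite !inE.
  by have := XY (K p); case: (X _) => // /(_ isT)/negPf.
split; apply: esum_disj.
- by apply: (disj (fun x => 0 < x) (fun x => x == 0)) => x; case: ltgtP.
- by apply: (disj (fun x => 0 < x) (fun x => x < 0)) => x; case: ltgtP.
by apply: (disj (fun x => x == 0) (fun x => x < 0)) => x; case: ltgtP.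
Qed.

(** [Jm] is the model at [z = 1], where all powers are 1. The anti-diagonal blocks have trace zero,
    so only the signs contribute to the trace. *)
Lemma model_involution (s : I -> int) :
  (forall p, K p = 0 -> s p = 1 \/ s p = -1) ->
  let Jm := esum e Xp *m Pr + Pr *m esum e Xp + esgn e X0 s in
  [/\ dg Jm = Jm, Jm *m Jm = 1%:M &
   \tr Jm = \sum_(p in X0) (s p)%:~R * \tr (e p)].
Proof.
move=> s1 Jm.
have [EpE0 EpEm E0Em] := esum_orth; have PrXp := Pr_Xp; have PrX0 := Pr_X0.
have E1 := esum_parts; set S := esgn e X0 s in Jm *.
have dEp : dg (esum e Xp) = esum e Xp by apply: dg_esum He _.
have dE0 : dg (esum e X0) = esum e X0 by apply: dg_esum He _.
have dEm : dg (esum e Xm) = esum e Xm by apply: dg_esum He _.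
have dS : dg S = S by apply: dg_esgn He _ _.
have EpEp : esum e Xp *m esum e Xp = esum e Xp by apply: esum_subl He _ _ _.
have E0S : esum e X0 *m S = S.
  rewrite /S /esgn mulmx_sumr; apply: eq_bigr => p pX.
  by rewrite -scalemxAr (mul_esum_e He) pX.
have SS : S *m S = esum e X0.
  rewrite {1}/S /esgn mulmx_suml; apply: eq_bigr => p pX.
  rewrite -scalemxAl (mul_e_esgn He) pX scalerA -rmorphM /=.
  by move: pX; rewrite inE => /eqP/s1[] ->; rewrite scale1r.
set Ep := esum e Xp in EpE0 EpEm PrXp E1 dEp EpEp Jm *.
set E0 := esum e X0 in EpE0 E0Em PrX0 E1 dE0 E0S SS.
set Em := esum e Xm in EpEm E0Em PrXp E1 dEm.
have PP : Ep *m Pr *m Ep = 0 by rewrite -mulmxA PrXp mulmxA EpEm mul0mx.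
have EpS : Ep *m S = 0 by rewrite -E0S mulmxA EpE0 mul0mx.
have EpPrS : Ep *m Pr *m S = 0.
  by rewrite -E0S -mulmxA [Pr *m _]mulmxA PrX0 !mulmxA EpE0 !mul0mx.
have SEp : S *m Ep = 0 by rewrite -[LHS]dgK dgM dS dEp EpS dg0.
have SPrEp : S *m Pr *m Ep = 0.
  by have := congr1 (@dg C n n) EpPrS; rewrite !dgM dgPr dS dEp mulmxA dg0.
have PrEpPr : Pr *m Ep *m Pr = Em by rewrite PrXp -mulmxA PrPr mulmx1.
split.
- by rewrite !dgD !dgM dgPr dS dEp [Pr *m Ep + _]addrC.
- rewrite /Jm !mulmxDl !mulmxDr !mulmxA PP EpPrS SEp SPrEp mul0mx SS.
  rewrite -[_ *m Pr *m Pr]mulmxA PrPr mulmx1 EpEp.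
  rewrite -[Pr *m Ep *m Ep]mulmxA EpEp PrEpPr.
  rewrite -[Pr *m Ep *m S]mulmxA EpS mulmx0.
  have -> : Em *m Ep = 0 by rewrite -[LHS]dgK dgM dEp dEm EpEm dg0.
  by rewrite !(addr0, add0r) addrAC.
have trP : \tr (Ep *m Pr) = 0.
  by rewrite -EpEp -mulmxA mxtrace_mulC PP mxtrace0.
rewrite !mxtraceD [\tr (Pr *m Ep)]mxtrace_mulC trP !add0r.
rewrite /S /esgn raddf_sum /=; apply: eq_bigr => p _.
by rewrite mxtraceZ.
Qed.

Lemma wh_reduce (P U V : 'M[{poly C}]_n) (a : C -> 'M[C]_n) :
  disk_unit P -> (b -> taup J P = P) -> U *m V = 1%:M ->
  (forall z, `|z| = 1 ->
      a z = ev P z *m (ev U z *m Dz (fun i => - k i) z) *m dg (ev P z)) ->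
  (forall z, `|z| = 1 -> dg (a z) = a z) ->
  (b -> forall z, `|z| = 1 -> tau J (a z^*) = a z) ->
  (forall i j (r : nat), 1 * (k i + k j) < r%:Z -> (U i j)`_r = 0) ->
  (forall i j (r : nat), -1 * (k i + k j) < r%:Z -> (V i j)`_r = 0) ->
  exists G s, [/\ disk_unit G, b -> taup J G = G,
    (forall p, K p = 0 -> s p = 1 \/ s p = -1) &
    forall z, `|z| = 1 -> a z = ev (P *m G) z *m
      (esum e Xp *m Dz k z *m Pr + Pr *m Dz (fun i => - k i) z *m esum e Xp +
       esgn e X0 s) *m dg (ev (P *m G) z)].
Proof.
move=> hP tP UV aE ah ta Uc Vc.
have VU : V *m U = 1%:M by apply: mulmx1C.
set Ep := esum e Xp; set E0 := esum e X0; set Em := esum e Xm.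
have dEp : dg Ep = Ep by apply: dg_esum He _.
have dE0 : dg E0 = E0 by apply: dg_esum He _.
have dEm : dg Em = Em by apply: dg_esum He _.
have fEp : isF Ep by apply: esum_fixed He _.
have fE0 : isF E0 by apply: esum_fixed He _.
have fEm : isF Em by apply: esum_fixed He _.
have EpEp : Ep *m Ep = Ep by apply: esum_subl He _ _ _.
have E0E0 : E0 *m E0 = E0 by apply: esum_subl He _ _ _.
have EmEm : Em *m Em = Em by apply: esum_subl He _ _ _.
have [EpE0 EpEm E0Em] : [/\ Ep *m E0 = 0, Ep *m Em = 0 & E0 *m Em = 0] by apply: esum_orth.
have E0Ep : E0 *m Ep = 0 by rewrite -[LHS]dgK dgM dEp dE0 EpE0 dg0.
have EmEp : Em *m Ep = 0 by rewrite -[LHS]dgK dgM dEp dEm EpEm dg0.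
have EmE0 : Em *m E0 = 0 by rewrite -[LHS]dgK dgM dE0 dEm E0Em dg0.
have E1 : Ep + E0 + Em = 1%:M by apply: esum_parts.
pose D' z : 'M[C]_n := Dz (fun i => - k i) z.
have [h hE] : exists h : C -> 'M[C]_n, forall z, h z = ev U z *m D' z.
  by exists (fun z => ev U z *m D' z).
have {}aE z : `|z| = 1 -> a z = ev P z *m h z *m dg (ev P z).
  by move=> z1; rewrite aE // hE.
have canP z M N : `|z| = 1 ->
    ev P z *m M *m dg (ev P z) = ev P z *m N *m dg (ev P z) -> M = N.
  move=> z1; have uP : ev P z \in unitmx by apply: hP; rewrite z1.
  have udP : dg (ev P z) \in unitmx by rewrite dg_unit.
  by move=> /(can_inj (mulmxK udP))/(can_inj (mulKmx uP)).
have dh z : `|z| = 1 -> dg (h z) = h z.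
  move=> z1; apply: (canP z) => //; rewrite -aE // -ah // aE //.
  by rewrite !dgM dgK !mulmxA.
have tau_ev M : (b -> taup J M = M) -> b -> forall z, tau J (ev M z^*) = ev M z.
  by move=> hM hb z; rewrite -ev_taup // hM.
have tD z : b -> tau J (Dz k z^*) = Dz k z by apply: tau_Dz K z.
have tD' z : b -> tau J (D' z^*) = D' z by apply: (tau_Dz (fun p => - K p)).
have th z : b -> `|z| = 1 -> tau J (h z^*) = h z.
  move=> hb z1; apply: (canP z) => //; rewrite -aE // -ta // aE ?circle_conj //.
  by rewrite !tauM // tau_dg // (tau_ev P).
(* Invariance passes from [a] to [h] because [P] is invariant and can be cancelled, and from [h] to
   [U] by cancelling the powers. *)
have tU : b -> taup J U = U.
  move=> hb; apply: ev_inj => z z1; rewrite ev_taup //.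
  have := th z hb z1; rewrite !hE tauM // tD' //.
  by apply/(can_inj (mulmxK _))/Dz_unit/circle_neq0.
have tV : b -> taup J V = V.
  move=> hb; rewrite -[LHS]mul1mx -VU -mulmxA -{1}tU // -taupM // UV.
  suff -> : taup J 1%:M = 1%:M by rewrite mulmx1.
  by apply: ev_inj => z _; rewrite ev_taup // !ev1 tau1.
have DE0 z : Dz k z *m E0 = E0 by apply: Dz_X0.
have D'E0 z : D' z *m E0 = E0 by apply: Dz_X0 => i ->; rewrite oppr0.
have E0D' z : E0 *m D' z = E0 by rewrite esum_Dz D'E0.
(* Between indices equal to zero the entries have degree at most 0, so the values at 0 give these
   blocks for all [z]. In [U *m V] and [V *m U], the paths from this block to itself through the
   other blocks vanish by the degree bounds; hence [W] inverts [M0]. *)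
set M0 := E0 *m ev U 0 *m E0; set W := E0 *m ev V 0 *m E0.
have u00 z : E0 *m ev U z *m E0 = M0 by apply: ev_block_const Uc.
have um0 z : Em *m ev U z *m E0 = 0.
  apply: ev_block0 Uc _ => p q; rewrite !inE => pm /eqP ->; lia.
have u0m z : E0 *m ev U z *m Em = 0.
  apply: ev_block0 Uc _ => p q; rewrite !inE => /eqP -> pm; lia.
have umm z : Em *m ev U z *m Em = 0.
  apply: ev_block0 Uc _ => p q; rewrite !inE => pm qm; lia.
have v0p z : E0 *m ev V z *m Ep = 0.
  apply: ev_block0 Vc _ => p q; rewrite !inE => /eqP -> pm; lia.
have vp0 z : Ep *m ev V z *m E0 = 0.
  apply: ev_block0 Vc _ => p q; rewrite !inE => pm /eqP ->; lia.
have E0W : E0 *m W = W by rewrite /W !mulmxA E0E0.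
have WE0 : W *m E0 = W by rewrite /W -mulmxA E0E0.
have inv00 (A B : 'M[C]_n) : A *m B = 1%:M ->
    E0 *m A *m Ep *m B *m E0 = 0 -> E0 *m A *m Em *m B *m E0 = 0 ->
    E0 *m A *m E0 *m (E0 *m B *m E0) = E0.
  move=> AB hp hm; have : E0 *m A *m (Ep + E0 + Em) *m B *m E0 = E0.
    by rewrite E1 mulmx1 -[E0 *m A *m B]mulmxA AB mulmx1 E0E0.
  rewrite !mulmxDr !mulmxDl hp hm add0r addr0 => E; rewrite -[RHS]E.
  by rewrite !mulmxA -[_ *m E0 *m E0]mulmxA E0E0.
have evUV z : ev U z *m ev V z = 1%:M by rewrite -evM UV ev1.
have evVU z : ev V z *m ev U z = 1%:M by rewrite -evM VU ev1.
have MW : M0 *m W = E0.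
  apply: inv00 => //; last by rewrite u0m !mul0mx.
  by rewrite -!mulmxA [Ep *m (_ *m E0)]mulmxA vp0 !mulmx0.
have WM : W *m M0 = E0.
  apply: inv00 => //; first by rewrite v0p !mul0mx.
  by rewrite -!mulmxA [Em *m (_ *m E0)]mulmxA um0 !mulmx0.
have dM0 : dg M0 = M0.
  have <- : E0 *m h 1 *m E0 = M0 by rewrite hE -mulmxA -[_ *m D' 1 *m E0]mulmxA D'E0 mulmxA u00.
  by rewrite !dgM dE0 dh ?normr1 // mulmxA.
have ev0_fixed M : (b -> taup J M = M) -> isF (ev M 0).
  by move=> hM hb; rewrite -[in LHS](conjC0 C) tau_ev.
have fM0 : isF M0 by do 2!apply: tau_fixedM => //; apply: ev0_fixed.
have fW : isF W by do 2!apply: tau_fixedM => //; apply: ev0_fixed.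
have dW : dg W = W.
  have dWM : dg W *m M0 = E0 by rewrite -{1}dM0 -dgM MW dE0.
  by rewrite -[LHS]dgK -E0W dgM dgK dE0 -{1}MW mulmxA dWM E0W.
have E0M0 : E0 *m M0 = M0 by rewrite /M0 !mulmxA E0E0.
clearbody M0 W.
have [B [s [fB sB sP M0E]]] := herm_congr HJ He dM0 fM0 E0M0.
rewrite -/E0 in sB; set S := esgn e X0 s in M0E.
have E0B : E0 *m B = B by rewrite -sB !mulmxA E0E0.
have BE0 : B *m E0 = B by rewrite -sB -mulmxA E0E0.
have E0S : E0 *m S = S.
  rewrite /S /esgn mulmx_sumr; apply: eq_bigr => p pX.
  by rewrite -scalemxAr (mul_esum_e He) pX.
have SE0 : S *m E0 = S by rewrite -[LHS]dgK dgM dE0 (dg_esgn He) E0S (dg_esgn He).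
(* [M0 = B *m S *m dg B] with inverse [W] makes [Y] the inverse of [B] on the block [E0]. *)
pose Y := S *m dg B *m W.
have BY : B *m Y = E0 by rewrite /Y !mulmxA -M0E MW.
have E0Y : E0 *m Y = Y by rewrite /Y !mulmxA E0S.
have BtY : (B + (Ep + Em)) *m (Y + (Ep + Em)) = 1%:M.
  have EpY : Ep *m Y = 0 by rewrite -E0Y mulmxA EpE0 mul0mx.
  have EmY : Em *m Y = 0 by rewrite -E0Y mulmxA EmE0 mul0mx.
  have BEp : B *m Ep = 0 by rewrite -BE0 -mulmxA E0Ep mulmx0.
  have BEm : B *m Em = 0 by rewrite -BE0 -mulmxA E0Em mulmx0.
  rewrite !mulmxDl !mulmxDr BY BEp BEm EpY EmY EpEp EmEm EpEm EmEp.
  by rewrite !(addr0, add0r) addrA [E0 + _]addrC E1.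
have [uBt _] := mulmx1_unit BtY.
(* A zero sign at [p] would make the rows of the invertible matrix [Y + (Ep + Em)] in block [p]
   vanish. *)
have s0 p : K p = 0 -> s p = 1 \/ s p = -1.
  move=> Kp; case: (sP p) => [sp0||]; [|by left|by right].
  have pX : p \in X0 by rewrite inE Kp.
  have epE0 : e p *m E0 = e p by rewrite (mul_e_esum He) pX.
  have epS : e p *m S = 0 by rewrite (mul_e_esgn He) pX sp0 scale0r.
  have epEpm : e p *m (Ep + Em) = 0.
    by rewrite -epE0 -mulmxA mulmxDr E0Ep E0Em addr0 mulmx0.
  have epY : e p *m (Y + (Ep + Em)) = 0.
    by rewrite mulmxDr epEpm addr0 /Y -[S *m dg B *m W]mulmxA mulmxA epS mul0mx.
  have /(congr1 (mulmx (e p))) := mulmx1C BtY.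
  by rewrite mulmx1 mulmxA epY mul0mx => /esym/eqP; rewrite (negPf (du_neq0 He p)).
(* The Schur complement at [(+,+)] without its powers of [z]: a polynomial matrix, to which
   [laurent_split] applies. *)
pose U3 := const_pmx Ep *m (U - U *m const_pmx W *m U) *m const_pmx Ep.
have EpD' z : Ep *m D' z = D' z *m Ep by apply: esum_Dz.
have EmD' z : Em *m D' z = D' z *m Em by apply: esum_Dz.
have EpD z : Ep *m Dz k z = Dz k z *m Ep by apply: esum_Dz.
pose f z := Ep *m ((ev U z - ev U z *m W *m ev U z) *m D' z) *m Ep.
have U3E z : ev U3 z *m D' z = f z.
  by rewrite !evM evB !evM !ev_const /f -!mulmxA EpD' !mulmxA.
have fE z : f z = Ep *m (h z - h z *m W *m h z) *m Ep.
  (* The powers are 1 on the index-zero block, so [u] may be replaced by the hermitian [h] next to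
     [W]; this shows that [f] is hermitian. *)
  have hW : h z *m W = ev U z *m W by rewrite hE -E0W mulmxA -[_ *m D' z *m E0]mulmxA D'E0 mulmxA.
  by rewrite /f mulmxBl hW hE !mulmxA.
have [T1 [T1' T1E]] := laurent_split U3 (fun i => - k i).
have [T2 [tT2 T2E]] : exists T2, (b -> taup J T2 = T2) /\
    forall z, `|z| = 1 -> f z = ev T2 z + dg (ev T2 z).
  apply: (herm_split HJ (T := T1) (T' := T1')) => [z z1|z z1|hb z z1].
  - by rewrite -U3E T1E.
  - by rewrite fE !dgM dEp dgB !dgM dh // dW !mulmxA.
  - rewrite !fE !tauM // (fEp hb) tauB // !tauM // th // (fW hb).
    by [].
pose T := const_pmx Ep *m T2 *m const_pmx Ep.
have EpT z : Ep *m ev T z = ev T z by rewrite !evM !ev_const !mulmxA EpEp.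
have TEp z : ev T z *m Ep = ev T z by rewrite !evM !ev_const -!mulmxA EpEp.
have Tspec z : `|z| = 1 -> ev T z + dg (ev T z) = f z.
  move=> z1; rewrite !evM !ev_const !dgM dEp mulmxA -mulmxDl -mulmxDr -T2E //.
  by rewrite /f !mulmxA EpEp -!mulmxA EpEp.
(* The polynomial matrix whose values are [gauge], with [Dp] in place of [D *m Ep]. *)
pose G := const_pmx Ep + (const_pmx E0 + const_pmx Ep *m U *m const_pmx W) *m const_pmx B +
  (T *m Dp + const_pmx Em *m U *m const_pmx Ep) *m const_pmx Pr.
have evG z : ev G z = gauge Ep E0 Em Pr (Dz k z) (ev U z) (ev T z) B W.
  rewrite /G 2!evD !(evM, ev_const) 2!evD !(evM, ev_const) ev_Dp.
  by [].
have PrXp := Pr_Xp; have PrXm := Pr_Xm; have PrX0 := Pr_X0.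
exists G, s; split => //.
- move=> z z1; rewrite evG; apply: gauge_unit => //.
  by have [] := mulmx1_unit (evUV z).
- move=> hb; apply: ev_inj => z z1; rewrite ev_taup // !evG /gauge.
  have cT : tau J (ev T z^*) = ev T z.
    by rewrite /T !evM !ev_const !tauM // (fEp hb) tau_ev.
  by rewrite !(tauD, tauM) // cT (tau_ev U) // tD // fEp // fE0 // fEm // fPr // fB // fW.
move=> z z1; rewrite aE // evM dgM evG -!mulmxA; congr (_ *m _).
rewrite !mulmxA; congr (_ *m _).
rewrite hE -[LHS](@gauge_congr _ _ Ep E0 Em Pr (Dz k z) (D' z) (ev U z) (ev T z) B S W M0) //.
- by apply: DzV; apply: circle_neq0.
- rewrite dg_Dz conj_circle //; congr diag_mx.
  by apply/rowP => i; rewrite !mxE exprz_inv.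
- by rewrite -hE dh.
- exact: Tspec.
Qed.

End Reduction.

(** * Inertia and sorting of signs *)

Section Inertia.
Variables (C : numClosedFieldType) (n : nat).
Implicit Types (M X Y Q : 'M[C]_n) (l s : 'rV[C]_n).

Lemma herm_spectral M : dg M = M -> exists Q l,
  [/\ Q *m dg Q = 1%:M, forall i, l 0 i \is Num.real & M = Q *m diag_mx l *m dg Q].
Proof.
move=> hM; have hs : M \is hermitianmx _ false Num.conj.
  by rewrite is_hermitianmxE expr0 scale1r -map_trmx -{1}hM.
have /orthomx_spectralP ME := hermitian_normalmx hs.
have uS := spectral_unitarymx M.
have dS : dg (spectralmx M) = invmx (spectralmx M).
  by rewrite invmx_unitary // -map_trmx.
exists (invmx (spectralmx M)), (spectral_diag M); split.
- by rewrite -dS dgK dS mulVmx // spectral_unit.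
- by move=> i; have /mxOverP := hermitian_spectral_diag_real hs; apply.
- by rewrite -{2}dS dgK.
Qed.

Lemma quad_diag l (w : 'rV[C]_n) :
  (w *m diag_mx l *m dg w) 0 0 = \sum_i l 0 i * `|w 0 i| ^+ 2.
Proof.
rewrite mxE; apply: eq_bigr => i _.
by rewrite mul_mx_diag dgE mxE normCK mulrAC mulrC.
Qed.

(* Otherwise some nonzero vector supported on the positive entries of [l] would
   be sent by [Y] to a vector vanishing on those of [s]. *)
Lemma inertia_le l s Y :
  (forall i, l 0 i \is Num.real) -> (forall i, s 0 i \is Num.real) ->
  diag_mx l = Y *m diag_mx s *m dg Y ->
  (#|[set i | (0 < l 0 i)%R]| <= #|[set i | (0 < s 0 i)%R]|)%N.
Proof.
move=> lr sr lE; set A := [set i | _ < l _ _]; set B := [set i | _ < s _ _].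
rewrite leqNgt; apply/negP => BA.
(* The rows of [Y] in [A], restricted to the columns in [B]: having more rows than columns, [N]
   kills a nonzero row vector [v], which [R] extends by zero to [w]. *)
pose N : 'M_(#|A|, #|B|) := \matrix_(i, j) Y (enum_val i) (enum_val j).
have : ~~ row_free N by rewrite -row_leq_rank -ltnNge (leq_ltn_trans (rank_leq_col N)).
rewrite -kermx_eq0 => /rowV0Pn[v /sub_kermxP vN v0].
pose R : 'M[C]_(#|A|, n) := \matrix_(i, j) (enum_val i == j)%:R.
pose w := v *m R.
have wA i : w 0 (enum_val i) = v 0 i.
  rewrite mxE (bigD1 i) //= mxE eqxx mulr1 big1 ?addr0 // => j ji.
  by rewrite mxE (inj_eq enum_val_inj) (negPf ji) mulr0.
have wnA j : j \notin A -> w 0 j = 0.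
  move=> jA; rewrite mxE big1 // => i _; rewrite mxE.
  case: eqP => [ij|_]; last by rewrite mulr0.
  by rewrite -ij enum_valP in jA.
have wYB j : j \in B -> (w *m Y) 0 j = 0.
  move=> jB; have /rowP/(_ (enum_rank_in jB j)) := vN; rewrite mxE [RHS]mxE => vNj.
  rewrite -mulmxA mxE -[RHS]vNj; apply: eq_bigr => i _; congr (_ * _).
  rewrite !mxE enum_rankK_in // (bigD1 (enum_val i)) //= mxE eqxx mul1r.
  by rewrite big1 ?addr0 // => m /negPf mi; rewrite mxE eq_sym mi mul0r.
clearbody w.
have : 0 < (w *m diag_mx l *m dg w) 0 0.
  have [i vi] : exists i, v 0 i != 0 by apply/rV0Pn.
  rewrite quad_diag (bigD1 (enum_val i)) //= ltr_pwDl //.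
    have := enum_valP i; rewrite inE => li.
    by rewrite mulr_gt0 // exprn_gt0 // normr_gt0 wA.
  apply: sumr_ge0 => j _; have [jA|/wnA ->] := boolP (j \in A).
    by move: jA; rewrite inE => /ltW lj; rewrite mulr_ge0 ?exprn_ge0.
  by rewrite normr0 expr0n mulr0.
rewrite lE.
have -> : w *m (Y *m diag_mx s *m dg Y) *m dg w =
   (w *m Y) *m diag_mx s *m dg (w *m Y) by rewrite dgM !mulmxA.
rewrite quad_diag => pos.
suff : \sum_i s 0 i * `|(w *m Y) 0 i| ^+ 2 <= 0.
  by move=> /(lt_le_trans pos); rewrite ltxx.
rewrite -oppr_ge0 -sumrN; apply: sumr_ge0 => j _.
have [jB|] := boolP (j \in B).
  by rewrite wYB // normr0 expr0n mulr0 oppr0.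
rewrite inE -real_leNgt ?real0 // => sj.
by rewrite -mulNr mulr_ge0 ?oppr_ge0 ?exprn_ge0.
Qed.

Lemma char_poly_conj M Q : Q *m dg Q = 1%:M ->
  char_poly (Q *m M *m dg Q) = char_poly M.
Proof.
move=> QQ; rewrite /char_poly.
have QQp : const_pmx Q *m const_pmx (dg Q) = 1%:M by rewrite -const_pmxM QQ /const_pmx map_mx1.
have -> : char_poly_mx (Q *m M *m dg Q) = const_pmx Q *m char_poly_mx M *m const_pmx (dg Q).
  rewrite /char_poly_mx mulmxBr mulmxBl scalar_mxC -[_%:M *m _ *m _]mulmxA QQp mulmx1.
  by rewrite !map_mxM.
by rewrite !det_mulmx mulrAC -det_mulmx QQp det1 mul1r.
Qed.

(** A hermitian involution has eigenvalues 1 and -1, so its trace counts them with sign. Inertia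
    applied to [Y] and to its inverse equates the numbers of positive eigenvalues of [M] and [Jm];
    the same for [- l] and [- s] equates the negative ones. *)
Lemma signature_involution M X Jm (rs : seq C) :
  dg Jm = Jm -> Jm *m Jm = 1%:M -> X \in unitmx -> M = X *m Jm *m dg X ->
  char_poly M = \prod_(x <- rs) ('X - x%:P) ->
  (count (fun x => 0 < x) rs)%:R - (count (fun x => x < 0) rs)%:R = \tr Jm.
Proof.
move=> hJ JJ uX ME cM.
have hM : dg M = M by rewrite ME !dgM dgK hJ mulmxA.
have [Q [l [QQ lr MQ]]] := herm_spectral hM.
have [W [s [WW sr JW]]] := herm_spectral hJ.
have QQ' : dg Q *m Q = 1%:M by apply: mulmx1C.
have WW' : dg W *m W = 1%:M by apply: mulmx1C.
have s2 i : s 0 i = 1 \/ s 0 i = -1.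
  have : diag_mx s *m diag_mx s = 1%:M.
    have <- : dg W *m (Jm *m Jm) *m W = 1%:M by rewrite JJ mulmx1.
    by rewrite JW !mulmxA WW' mul1mx -!mulmxA [dg W *m (W *m _)]mulmxA WW' mul1mx mulmx1.
  rewrite mulmx_diag => /matrixP/(_ i i); rewrite !mxE eqxx !mulr1n -expr2 => /eqP.
  by rewrite sqrf_eq1 => /orP[] /eqP; [left|right].
pose Y := dg Q *m X *m W.
have lY : diag_mx l = Y *m diag_mx s *m dg Y.
  have -> : diag_mx l = dg Q *m M *m Q.
    by rewrite MQ !mulmxA QQ' mul1mx -mulmxA QQ' mulmx1.
  by rewrite ME JW /Y !dgM dgK !mulmxA.
have uQ : Q \in unitmx by have [] := mulmx1_unit QQ.
have uW : W \in unitmx by have [] := mulmx1_unit WW.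
have uY : Y \in unitmx by rewrite !unitmx_mul dg_unit uQ uX.
clearbody Y.
have sY : diag_mx s = invmx Y *m diag_mx l *m dg (invmx Y).
  rewrite lY !mulmxA mulVmx // mul1mx -mulmxA -dgM mulVmx // dg1 mulmx1.
  by [].
have dN (r : 'rV[C]_n) : diag_mx (- r) = - diag_mx r by rewrite linearN.
have pos : #|[set i | 0 < l 0 i]| = #|[set i | 0 < s 0 i]|.
  by apply/eqP; rewrite eqn_leq (inertia_le lr sr lY) (inertia_le sr lr sY).
have nr (r : 'rV[C]_n) : (forall i, r 0 i \is Num.real) ->
    forall i, (- r) 0 i \is Num.real by move=> h i; rewrite mxE rpredN.
have neg : #|[set i | l 0 i < 0]| = #|[set i | s 0 i < 0]|.
  have E (r : 'rV[C]_n) : [set i | r 0 i < 0] = [set i | 0 < (- r) 0 i].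
    by apply/setP => i; rewrite !inE mxE oppr_gt0.
  rewrite !E; apply/eqP; rewrite eqn_leq.
  rewrite (@inertia_le (- l) (- s) Y) ?(@inertia_le (- s) (- l) (invmx Y)) //;
    try exact: nr; by rewrite !dN mulmxN mulNmx -?lY -?sY.
have /prod_XsubC_eq/seq.permP cnt :
    \prod_(x <- rs) ('X - x%:P) = \prod_(x <- [seq l 0 i | i <- enum 'I_n]) ('X - x%:P).
  rewrite -cM MQ char_poly_conj // char_poly_trig ?diag_mx_is_trig //.
  by rewrite big_map big_enum; apply: eq_bigr => i _; rewrite mxE eqxx mulr1n.
have cntE (p : pred C) : count p rs = #|[set i | p (l 0 i)]|.
  by rewrite cnt count_map -sum1_card -sum1_count big_enum_cond; apply: eq_bigl => i; rewrite inE.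
rewrite !cntE pos neg JW -mulmxA mxtrace_mulC -mulmxA WW' mulmx1 mxtrace_diag.
rewrite -!sum1_card !natr_sum big_mkcond [X in _ - X]big_mkcond /= -sumrB.
apply: eq_bigr => i _; rewrite !inE.
case: (s2 i) => ->; first by rewrite ltr01 ltr10 subr0.
by rewrite oppr_gt0 oppr_lt0 ltr01 ltr10 sub0r.
Qed.

End Inertia.

(** Rearrangement inequality: take [t] maximizing the sum of [m * s (t m)] among the permutations of
    [X]; exchanging two values in the wrong order would increase the sum strictly. *)
Lemma sort_signs d (X : {set 'I_d}) (s : 'I_d -> int) :
  exists t : 'S_d, perm_on X t /\
    forall m m', m \in X -> m' \in X -> (m < m')%N -> s (t m) <= s (t m').
Proof.
pose F (t : 'S_d) : int := \sum_(m < d) (m : nat)%:Z * s (t m).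
have [t tX tmax] := @Order.TotalTheory.arg_maxP _ _ _ (1%g : 'S_d) (perm_on X) F (perm_on1 X).
exists t; split=> // m m' mX m'X mm'; rewrite leNgt; apply/negP => lts.
have mn : m' != m by apply: contraTneq mm' => ->; rewrite ltnn.
pose t' := (tperm m m' * t)%g.
have t'X : perm_on X t'.
  apply: perm_onM => //; apply/subsetP => x; rewrite inE.
  by apply: contraR => xX; rewrite tpermD //; apply: contraNneq xX => <-.
have : F t' <= F t := tmax _ t'X; rewrite /F leNgt => /negP; apply.
rewrite (bigD1 m) // (bigD1 m') //= [ltRHS](bigD1 m) // (bigD1 m') //=.
rewrite !permM tpermL tpermR.
have -> : \sum_(i < d | (i != m) && (i != m')) (i : nat)%:Z * s (t' i) =
          \sum_(i < d | (i != m) && (i != m')) (i : nat)%:Z * s (t i).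
  by apply: eq_bigr => i /andP[im im']; rewrite permM tpermD // eq_sym.
rewrite !addrA ltrD2r; nia.
Qed.

(** * The embedding of F_d in the complex matrices *)

Section BlockScalars.
Variables (R : realType) (F : fkind) (d : nat).
Local Notation C := R[i].
Local Notation n := (d * bsz F)%N.

Lemma blk_mod_inj (i j : 'I_n) : blk i = blk j -> (i %% bsz F = j %% bsz F)%N -> i = j.
Proof.
move=> /(congr1 val) /= bij mij; apply: val_inj => /=.
by rewrite (divn_eq i (bsz F)) (divn_eq j (bsz F)) bij mij.
Qed.

Lemma mkix_proof (p : 'I_d) (r : nat) : (r < bsz F)%N -> (p * bsz F + r < n)%N.
Proof.
move=> rb; apply: (@leq_trans (p.+1 * bsz F)); first by rewrite mulSn addnC ltn_add2r.
by rewrite leq_mul2r ltn_ord orbT.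
Qed.

Lemma mkix (p : 'I_d) (r : nat) : (r < bsz F)%N ->
  exists2 i : 'I_n, blk i = p & (i %% bsz F)%N = r.
Proof.
move=> rb; exists (Ordinal (mkix_proof p rb)).
  by apply: val_inj; rewrite /= divnMDl ?bsz_gt0 // divn_small // addn0.
by rewrite /= modnMDl modn_small.
Qed.

(* [tens1 M] is [M (x) 1_F]. *)
Definition tens1 (M : 'M[C]_d) : 'M[C]_n :=
  \matrix_(i, j) (M (blk i) (blk j) * (i %% bsz F == j %% bsz F)%N%:R).

Lemma sum_blk (i : 'I_n) (f : 'I_d -> C) :
  \sum_(k < n) f (blk k) * (i %% bsz F == k %% bsz F)%N%:R = \sum_p f p.
Proof.
rewrite (partition_big (@blk F d) predT) //=; apply: eq_bigr => p _.
have [k0 k0p k0i] := mkix p (ltn_pmod i (bsz_gt0 F)).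
rewrite (bigD1 k0) ?k0p //= k0i eqxx mulr1 big1 ?addr0 // => k /andP[/eqP kp kk0].
case: eqP => [ki|_]; last by rewrite mulr0.
by case/eqP: kk0; apply: blk_mod_inj; rewrite ?kp ?k0p // -ki k0i.
Qed.

Lemma tens1M M N : tens1 (M *m N) = tens1 M *m tens1 N.
Proof.
apply/matrixP => i j; rewrite !mxE mulr_suml -(sum_blk i); apply: eq_bigr => k _.
rewrite !mxE [X in _ = X]mulrACA -!mulrA; congr (_ * (_ * _)).
rewrite -!natrM !mulnb; congr (_%:R).
by case: (i %% _ =P k %% _)%N => [->|_]; rewrite ?andbT ?andbF.
Qed.

Lemma tens1_1 : tens1 1%:M = 1%:M.
Proof.
apply/matrixP => i j; rewrite !mxE -natrM mulnb; congr (_%:R); congr (nat_of_bool _).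
apply/andP/eqP => [[/eqP h /eqP h']|->]; first exact: blk_mod_inj.
by rewrite !eqxx.
Qed.

Lemma dg_tens1 M : dg (tens1 M) = tens1 (dg M).
Proof. by apply/matrixP => i j; rewrite !mxE rmorphM rmorph_nat eq_sym. Qed.

Lemma tens1_sum (I : finType) (P : pred I) (f : I -> 'M[C]_d) :
  tens1 (\sum_(p | P p) f p) = \sum_(p | P p) tens1 (f p).
Proof.
apply: (big_morph tens1) => [M N|].
  by apply/matrixP => i j; rewrite !mxE mulrDl.
by apply/matrixP => i j; rewrite !mxE mul0r.
Qed.

Lemma munitE m m' : munit R F m m' = tens1 (delta_mx m m').
Proof.
apply/matrixP => i j; rewrite !mxE -natrM mulnb; congr (_%:R).
Qed.

Lemma card_blk (p : 'I_d) : #|[pred i : 'I_n | blk i == p]| = bsz F.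
Proof.
pose f (r : 'I_(bsz F)) : 'I_n := Ordinal (mkix_proof p (ltn_ord r)).
have finj : injective f.
  by move=> r r' /(congr1 val) /= /addnI /val_inj.
rewrite -[RHS]card_ord -(card_imset _ finj); apply: eq_card => i; rewrite !inE.
apply/eqP/imsetP => [ip|[r _ ->]].
  exists (Ordinal (ltn_pmod i (bsz_gt0 F))) => //; apply: val_inj => /=.
  by rewrite [LHS](divn_eq i (bsz F)) -ip.
by apply: val_inj; rewrite /= divnMDl ?bsz_gt0 // divn_small // addn0.
Qed.

Lemma mxtrace_tens1 M : \tr (tens1 M) = (bsz F)%:R * \tr M.
Proof.
rewrite /mxtrace; under eq_bigr do rewrite mxE eqxx mulr1.
rewrite (partition_big (@blk F d) predT) //= mulr_sumr; apply: eq_bigr => p _.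
under eq_bigr => i /eqP -> do [].
by rewrite sumr_const card_blk mulr_natl.
Qed.

(** For H this is [i sigma_y] in every diagonal block, with rows 0 1 and -1 0: the parity of an
    index is its position within the block. Conjugation followed by this change of basis fixes
    exactly the quaternions. *)
Definition Jmx : 'M[C]_n :=
  \matrix_(i, j) if F is FH then
     (blk i == blk j)%:R * ((odd j)%:R - (odd i)%:R) else (i == j)%:R.

End BlockScalars.

Definition is_RH (F : fkind) : bool := if F is FC then false else true.

Section Quaternions.
Variables (R : realType) (d : nat).
Local Notation C := R[i].

Lemma ixP (i : 'I_(d * bsz FH)) : i = ix (blk i) (odd i).
Proof.
by apply: val_inj; rewrite /= -modn2 -divn_eq.
Qed.

Lemma blk_ix (p : 'I_d) e : @blk FH d (ix p e) = p.
Proof. by apply: val_inj; rewrite /= divnMDl // divn_small ?addn0 //; case: e. Qed.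

Lemma odd_ix (p : 'I_d) e : odd (ix p e) = e.
Proof. by rewrite /= oddD oddM andbF; case: e. Qed.

Lemma ix_ind (P : 'I_(d * bsz FH) -> Prop) :
  (forall p e, P (ix p e)) -> forall i, P i.
Proof. by move=> h i; rewrite (ixP i). Qed.

Lemma mul_Jmx (M : 'M[C]_(d * bsz FH)) p e j :
  (Jmx R FH d *m M) (ix p e) j = (-1) ^+ e * M (ix p (~~ e)) j.
Proof.
rewrite mxE (bigD1 (ix p (~~ e))) //= mxE !blk_ix eqxx mul1r !odd_ix big1 ?addr0.
  by case: e; rewrite ?subr0 ?sub0r.
move=> k ke; rewrite mxE blk_ix odd_ix; elim/ix_ind: k ke => q e' ke.
rewrite blk_ix odd_ix; case: eqP => [pk|_]; last by rewrite !mul0r.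
have -> : e' = e; last by rewrite subrr mulr0 mul0r.
by rewrite pk in ke; case: e e' ke => [] [] //; rewrite eqxx.
Qed.

Lemma Jmx_tr : (Jmx R FH d)^T = - Jmx R FH d.
Proof. by apply/matrixP => i j; rewrite !mxE eq_sym -mulrN opprB. Qed.

Lemma Jmx_sq : Jmx R FH d *m Jmx R FH d = (-1)%:M.
Proof.
apply/matrixP => i j; elim/ix_ind: i => p e; elim/ix_ind: j => q e'.
rewrite mul_Jmx !mxE !blk_ix !odd_ix.
have -> : (ix p e == ix q e') = (p == q) && (e == e').
  apply/eqP/andP => [h|[/eqP-> /eqP->]] //.
  by rewrite -(blk_ix p e) -{2}(odd_ix p e) h blk_ix odd_ix !eqxx.
case: (p == q); last by rewrite !mul0r mulr0.
by case: e e' => [] [] /=; rewrite ?subr0 ?sub0r ?subrr ?mulr0 ?mulr1 ?mul1r ?mulN1r.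
Qed.

Lemma structure_FH : structure_mx (Jmx R FH d).
Proof.
split.
- rewrite Jmx_tr mulmxN Jmx_sq; apply/matrixP => i j; rewrite !mxE.
  by rewrite mulNrn opprK.
- by apply/matrixP => i j; rewrite !mxE rmorphM rmorphB !rmorph_nat.
by exists (-1); [rewrite mulrNN mulr1|apply: Jmx_sq].
Qed.

Lemma tau_FH (M : 'M[C]_(d * bsz FH)) p q e e' :
  tau (Jmx R FH d) M (ix p e) (ix q e') =
    (-1) ^+ e * (-1) ^+ e' * (M (ix p (~~ e)) (ix q (~~ e')))^*.
Proof.
rewrite /tau -mulmxA mul_Jmx -mulrA; congr (_ * _).
rewrite -[_ *m _]trmxK trmx_mul trmxK mxE.
by rewrite mul_Jmx !mxE.
Qed.

Lemma inF_FH (M : 'M[C]_(d * bsz FH)) :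
  inF (F := FH) M <-> tau (Jmx R FH d) M = M.
Proof.
split=> [h|h p q].
  apply/matrixP => i j; elim/ix_ind: i => p e; elim/ix_ind: j => q e'.
  have [h1 h2] := h p q; rewrite tau_FH.
  case: e e' => [] [] /=; rewrite !(mul1r, mulr1, mulN1r, mulNr, opprK).
  - by rewrite h1.
  - by rewrite h2.
  - by rewrite h2 rmorphN /= opprK conjCK.
  - by rewrite h1 conjCK.
split.
  by rewrite -{1}h tau_FH /= mulrNN !mulr1 mul1r.
by rewrite -{1}h tau_FH /= mulr1 mulN1r.
Qed.

End Quaternions.

Section Fields.
Variables (R : realType) (d : nat).

Lemma Jmx_FR : Jmx R FR d = 1%:M.
Proof. by apply/matrixP => i j; rewrite !mxE. Qed.
Lemma Jmx_FC : Jmx R FC d = 1%:M.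
Proof. by apply/matrixP => i j; rewrite !mxE. Qed.
End Fields.

Lemma structure_1 (C : numClosedFieldType) n : structure_mx (1%:M : 'M[C]_n).
Proof. by split; rewrite ?trmx1 ?mulmx1 ?map_mx1 //; exists 1; rewrite ?mulr1 ?mulmx1. Qed.

Lemma structure_Jmx (R : realType) F d : structure_mx (Jmx R F d).
Proof.
case: F; [rewrite Jmx_FR|rewrite Jmx_FC|exact: structure_FH]; exact: structure_1.
Qed.

Lemma inF_tau (R : realType) F d (M : 'M[R[i]]_(d * bsz F)) :
  inF M <-> tau_fixed (is_RH F) (Jmx R F d) M.
Proof.
case: F M => M.
- rewrite /tau_fixed /tau Jmx_FR trmx1 mulmx1 mul1mx.
  split=> [h _|h i j]; first by apply/matrixP => i j; rewrite mxE h.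
  by rewrite -[RHS]/(M i j) -{2}(h isT) mxE.
- by split.
by rewrite inF_FH; split=> [h _|h]; [|apply: h].
Qed.

Lemma tens1_fixed (R : realType) F d (M : 'M[R[i]]_d) :
  (forall p q, (M p q)^* = M p q) -> tau_fixed (is_RH F) (Jmx R F d) (tens1 F M).
Proof.
move=> Mr; apply/inF_tau; case: F => //= [i j|p q].
  by rewrite mxE rmorphM /= rmorph_nat Mr.
rewrite !mxE !blk_ix /= !modnMDl /= !mulr1 !mulr0 Mr.
by rewrite rmorph0 oppr0.
Qed.

Definition blk_unit (R : realType) F d (p : 'I_d) : 'M[R[i]]_(d * bsz F) :=
  diag_mx (\row_i (blk i == p)%:R).

Lemma blk_unitE (R : realType) F d (p : 'I_d) : blk_unit R F p = tens1 F (delta_mx p p).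
Proof.
apply/matrixP => i j; rewrite !mxE -mulrnA -natrM; congr (_%:R).
case: (i =P j) => [->|ij]; first by rewrite muln1 eqxx muln1 andbb.
rewrite muln0; case: eqP => //= ip; case: eqP => //= jp; case: eqP => //= mij.
by case: ij; apply: blk_mod_inj; rewrite ?ip ?jp.
Qed.

Lemma dg_delta (C : numClosedFieldType) d (p q : 'I_d) :
  dg (delta_mx p q : 'M[C]_d) = delta_mx q p.
Proof. by apply/matrixP => i j; rewrite !mxE rmorph_nat andbC. Qed.

Lemma blk_unit_fixed (R : realType) F d (p : 'I_d) :
  tau_fixed (is_RH F) (Jmx R F d) (blk_unit R F p).
Proof. by rewrite blk_unitE; apply: tens1_fixed => q r; rewrite mxE rmorph_nat. Qed.

Lemma blk_unit_entry (R : realType) F d (p : 'I_d) (N : 'M[R[i]]_(d * bsz F)) i j :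
  (blk_unit R F p *m N *m blk_unit R F p) i j = (blk i == p)%:R * N i j * (blk j == p)%:R.
Proof. by rewrite mul_mx_diag mxE mul_diag_mx !mxE. Qed.

Lemma blk_unit_scal (R : realType) F d (p : 'I_d) (N : 'M[R[i]]_(d * bsz F)) :
  dg N = N -> tau_fixed (is_RH F) (Jmx R F d) N ->
  exists2 r : R[i], r^* = r & blk_unit R F p *m N *m blk_unit R F p = r *: blk_unit R F p.
Proof.
move=> hN /inF_tau fN; have [k kp k0] := mkix p (bsz_gt0 F).
exists (N k k); first by rewrite -[in RHS]hN dgE.
apply/matrixP => i j; rewrite blk_unit_entry !mxE.
have [ip|] := eqVneq (blk i) p; last by rewrite !mul0r mul0rn mulr0.
have [jp|jp] := eqVneq (blk j) p; last first.
  rewrite mulr0; case: eqP => [ij|]; last by rewrite mulr0.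
  by rewrite -ij ip eqxx in jp.
rewrite mul1r mulr1.
case: F N hN fN k kp k0 i j ip jp => N hN fN k kp k0 i j ip jp.
- have -> : i = k by apply: blk_mod_inj; rewrite ?kp ?ip ?modn1.
  have -> : j = k by apply: blk_mod_inj; rewrite ?kp ?jp ?modn1.
  by rewrite eqxx mulr1.
- have -> : i = k by apply: blk_mod_inj; rewrite ?kp ?ip ?modn1.
  have -> : j = k by apply: blk_mod_inj; rewrite ?kp ?jp ?modn1.
  by rewrite eqxx mulr1.
have kE : k = ix p false.
  by apply: blk_mod_inj; rewrite ?kp ?blk_ix ?k0 //= addn0 modnMl.
have [h1 h2] := fN p p; have hd i' j' : N i' j' = (N j' i')^* by rewrite -dgE hN.
(* The quaternionic form makes this entry minus the conjugate of its mirror image, hermitian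
   symmetry makes it plus that conjugate. *)
have N01 : N (ix p true) (ix p false) = 0.
  apply/eqP; move: h2; rewrite -hd => /eqP; rewrite -addr_eq0 -mulr2n mulrn_eq0.
  by [].
have neq e : (ix p e == ix p (~~ e)) = false.
  apply/negP => /eqP/(congr1 (fun i : 'I_(d * bsz FH) => odd i)).
  by rewrite !odd_ix; case: e.
rewrite (ixP i) (ixP j) ip jp kE.
case: (odd i) (odd j) => [] []; rewrite ?eqxx ?mulr1 //.
- by rewrite h1 -hd.
- by rewrite N01 (neq true) mulr0.
- by rewrite hd N01 rmorph0 (neq false) mulr0.
Qed.

Lemma blk_unit_units (R : realType) F d :
  diag_units (is_RH F) (Jmx R F d) (@blk_unit R F d).
Proof.
split=> [p|p q pq|p||p|p|p N].
- by rewrite blk_unitE -tens1M mul_delta_mx.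
- rewrite !blk_unitE -tens1M mul_delta_mx_0 //.
  by apply/matrixP => i j; rewrite !mxE mul0r.
- by rewrite blk_unitE dg_tens1 dg_delta.
- under eq_bigr do rewrite blk_unitE.
  by rewrite -tens1_sum -mx1_sum_delta tens1_1.
- have [k kp _] := mkix p (bsz_gt0 F).
  apply/eqP => /matrixP/(_ k k); rewrite !mxE kp !eqxx => /eqP.
  by rewrite oner_eq0.
- exact: blk_unit_fixed.
exact: blk_unit_scal.
Qed.

(** * Laurent matrix polynomials as lists of coefficients *)

Section Laurent.
Variable C : numClosedFieldType.

(** A class of functions closed under sums and products in which equality on the circle extends to
    all [z != 0]; it avoids computing with coefficient lists of products. *)
Definition laurent (f : C -> C) := exists (N : nat) (p : {poly C}),
  forall z, z != 0 -> z ^+ N * f z = p.[z].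

Lemma laurent_circle f : laurent f -> (forall z, `|z| = 1 -> f z = 0) ->
  forall z, z != 0 -> f z = 0.
Proof.
move=> [N [p fp]] f0 z z0; apply: (mulfI (expf_neq0 N z0)); rewrite mulr0 fp //.
suff -> : p = 0 by rewrite horner0.
by apply: poly_circle0 => w w1; rewrite -fp ?circle_neq0 // f0 // mulr0.
Qed.

Lemma laurentC c : laurent (fun=> c).
Proof. by exists 0%N, c%:P => z _; rewrite hornerC expr0 mul1r. Qed.

Lemma laurentM f g : laurent f -> laurent g -> laurent (fun z => f z * g z).
Proof.
move=> [N [p fp]] [M [q gq]]; exists (N + M)%N, (p * q) => z z0.
by rewrite hornerM -fp // -gq // exprD mulrACA.
Qed.

Lemma laurentD f g : laurent f -> laurent g -> laurent (fun z => f z + g z).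
Proof.
move=> [N [p fp]] [M [q gq]]; exists (N + M)%N, ('X^M * p + 'X^N * q) => z z0.
by rewrite !hornerE -fp // -gq // exprD; ring.
Qed.

Lemma laurentXz (k : int) : laurent (fun z => z ^ k).
Proof.
case: k => m; first by exists 0%N, 'X^m => z _; rewrite hornerXn expr0 mul1r.
exists m.+1, 1 => z z0; rewrite NegzE -exprnN mulfV ?expf_neq0 //.
by rewrite hornerC.
Qed.

Lemma laurent_sum (I : Type) (r : seq I) (P : pred I) (f : I -> C -> C) :
  (forall i, laurent (f i)) -> laurent (fun z => \sum_(i <- r | P i) f i z).
Proof.
move=> h; elim: r => [|i r IH].
  by case: (laurentC 0) => N [p hp]; exists N, p => z; rewrite big_nil; apply: hp.
case: (boolP (P i)) => Pi.
  have [N [p hp]] := laurentD (h i) IH; exists N, p => z.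
  by rewrite big_cons Pi; apply: hp.
have [N [p hp]] := IH; exists N, p => z.
by rewrite big_cons (negPf Pi); apply: hp.
Qed.

Definition mlaurent n (f : C -> 'M[C]_n) := forall i j, laurent (fun z => f z i j).

Lemma mlaurentC n (M : 'M[C]_n) : mlaurent (fun=> M).
Proof. by move=> i j; apply: laurentC. Qed.

Lemma mlaurentD n (f g : C -> 'M[C]_n) :
  mlaurent f -> mlaurent g -> mlaurent (fun z => f z + g z).
Proof.
move=> hf hg i j; have [N [p hp]] := laurentD (hf i j) (hg i j).
by exists N, p => z; rewrite mxE; apply: hp.
Qed.

Lemma mlaurentM n (f g : C -> 'M[C]_n) :
  mlaurent f -> mlaurent g -> mlaurent (fun z => f z *m g z).
Proof.
move=> hf hg i j.
have [N [p hp]] := @laurent_sum _ (index_enum 'I_n) xpredT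
  (fun k z => f z i k * g z k j) (fun k => laurentM (hf i k) (hg k j)).
by exists N, p => z; rewrite mxE; apply: hp.
Qed.

Lemma mlaurentZ n (k : int) (M : 'M[C]_n) : mlaurent (fun z => z ^ k *: M).
Proof.
move=> i j; have [N [p hp]] := laurentM (laurentXz k) (laurentC (M i j)).
by exists N, p => z; rewrite mxE; apply: hp.
Qed.

Lemma mlaurent_sum n (I : Type) (r : seq I) (P : pred I) (f : I -> C -> 'M[C]_n) :
  (forall i, mlaurent (f i)) -> mlaurent (fun z => \sum_(i <- r | P i) f i z).
Proof.
move=> h i j; have [N [p hp]] := laurent_sum r P (fun k => h k i j).
by exists N, p => z; rewrite summxE; apply: hp.
Qed.

Lemma mlaurent_circle n (f g : C -> 'M[C]_n) : mlaurent f -> mlaurent g ->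
  (forall z, `|z| = 1 -> f z = g z) -> forall z, z != 0 -> f z = g z.
Proof.
move=> hf hg fg z z0; apply/matrixP => i j; apply/eqP; rewrite -subr_eq0; apply/eqP.
have L := laurentD (hf i j) (laurentM (laurentC (-1)) (hg i j)).
have := laurent_circle L _ z0; rewrite mulN1r; apply=> w w1.
by rewrite mulN1r fg // subrr.
Qed.

End Laurent.

Section Conversions.
Variables (R : realType) (n : nat).
Local Notation C := R[i].
Implicit Types (A : lpoly R n) (P : 'M[{poly C}]_n) (z : C).

Lemma lcoef_nth A (k : nat) : lcoef A (lp_low A + k%:Z) = (lp_coef A)`_k.
Proof. by rewrite /lcoef addrAC subrr add0r. Qed.

Lemma mlaurent_leval A : mlaurent (leval A).
Proof. by apply: mlaurent_sum => k; apply: mlaurentZ. Qed.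

(** Common core of [ldag] and [lsubinv]: both reverse the list and start at minus the top degree,
    which is [l + size s - 1]. *)
Lemma leval_rev (l : int) (s : seq 'M[C]_n) z :
  leval (LPoly (- (l + (size s)%:Z - 1)) (rev s)) z =
  \sum_(k < size s) (z^-1) ^ (l + k%:Z) *: s`_k.
Proof.
rewrite /leval /= size_rev (reindex_inj rev_ord_inj) /=; apply: eq_bigr => k _.
rewrite exprz_inv nth_rev ?ltn_subrL //; last by case: (size s) k => [[]|].
have ks := ltn_ord k.
congr (_ ^ _ *: s`_ _); last by rewrite subnS subKn ?prednK.
by lia.
Qed.

Lemma leval_lsubinv A z : leval (lsubinv A) z = leval A z^-1.
Proof. by rewrite /lsubinv leval_rev. Qed.

Lemma leval_ldag A z : leval (ldag A) z = dg (leval A (z^*)^-1).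
Proof.
rewrite /ldag -(size_map (@mxdag R n)) leval_rev size_map /leval.
rewrite dg_sum; apply: eq_bigr => k _; rewrite (nth_map 0) // dgZ.
by rewrite fmorphXz fmorphV /= conjCK.
Qed.

(** [lp_low] may be negative even for a polynomial in [z], with zero coefficients stored there.
    Dropping these terms gives equality at [z = 0] too. *)
Lemma poly_of_lpoly A : is_polyz A -> exists P, forall z, leval A z = ev P z.
Proof.
move=> hA; pose e (k : nat) := lp_low A + k%:Z.
pose P := \sum_(k < size (lp_coef A))
  (if 0 <= e k then 'X^(absz (e k)) *: const_pmx (lp_coef A)`_k else 0).
exists P => z; rewrite /leval /P.
have -> : forall r (G : 'I_r -> 'M[{poly C}]_n), ev (\sum_k G k) z = \sum_k ev (G k) z.
  by move=> r G; rewrite /ev raddf_sum.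
apply: eq_bigr => k _; case: ifPn => ek.
  by rewrite ev_scale ev_const hornerXn exprnP gez0_abs.
rewrite -ltNge in ek; rewrite -lcoef_nth hA // scaler0.
by rewrite /ev map_mx0.
Qed.

Definition lpoly_of P : lpoly R n :=
  LPoly 0 [seq map_mx (coefp k) P | k <- iota 0 (\max_i \max_j size (P i j))].

Lemma size_entry P i j : (size (P i j) <= \max_i \max_j size (P i j))%N.
Proof.
by apply: leq_trans (leq_bigmax i); apply: (leq_bigmax (F := fun j => size (P i j))).
Qed.

Lemma leval_lpoly_of P z : leval (lpoly_of P) z = ev P z.
Proof.
rewrite /leval /= size_map size_iota; set N := \max_i _.
apply/matrixP => i j; rewrite summxE evE (horner_coef_wide _ (size_entry P i j)).
apply: eq_bigr => k _; rewrite (nth_map 0%N) ?size_iota // nth_iota // add0n add0r.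
by rewrite !mxE -exprnP mulrC.
Qed.

Lemma lcoef_lpoly_of P (k : nat) : lcoef (lpoly_of P) k = map_mx (coefp k) P.
Proof.
have := lcoef_nth (lpoly_of P) k; rewrite add0r => -> /=; set N := \max_i _.
have [kN|Nk] := ltnP k N.
  by rewrite (nth_map 0%N) ?size_iota // nth_iota.
rewrite nth_default ?size_map ?size_iota //; apply/matrixP => i j; rewrite !mxE.
by rewrite nth_default // (leq_trans (size_entry P i j)).
Qed.

Lemma is_polyz_lpoly_of P : is_polyz (lpoly_of P).
Proof. by case=> // k _; rewrite /lcoef subr0. Qed.

End Conversions.

Section FieldCoefficients.
Variables (R : realType) (F : fkind) (d : nat).
Local Notation C := R[i].
Local Notation J := (Jmx R F d).

Lemma tau_leval (A : lpoly R (d * bsz F)) z : lpoly_inF A -> is_RH F ->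
  tau J (leval A z^*) = leval A z.
Proof.
move=> hA hF; rewrite /leval.
rewrite (big_morph (tau J) (tauD J) (@tau_fixed0 true _ _ J isT)).
apply: eq_bigr => k _; rewrite tauZ fmorphXz /= conjCK; congr (_ *: _).
by rewrite -lcoef_nth; have /inF_tau := hA (lp_low A + k%:Z); apply.
Qed.

Lemma lpoly_inF_of (P : 'M[{poly C}]_(d * bsz F)) :
  (is_RH F -> taup J P = P) -> lpoly_inF (lpoly_of P).
Proof.
move=> hP [k|k]; apply/inF_tau => hF; last first.
  by rewrite /lcoef subr0; apply: tau_fixed0 hF.
rewrite lcoef_lpoly_of -[in RHS]hP //; apply/matrixP => i j.
rewrite /taup /tau !mxE /= coef_sum; apply: eq_bigr => m _.
rewrite [const_pmx _ _ _]mxE coefMC !mxE /= coef_sum !mulr_suml; apply: eq_bigr => l _.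
by rewrite !mxE coefCM coef_map.
Qed.

End FieldCoefficients.

(** * The factorization *)

Section Assembly.
Variables (R : realType) (F : fkind) (d : nat).
Local Notation C := R[i].
Local Notation n := (d * bsz F)%N.
Local Notation J := (Jmx R F d).
Local Notation e := (@blk_unit R F d).
Let He := blk_unit_units R F d.
Let HJ := structure_Jmx R F d.

Definition blk_perm_mx (t : 'S_d) : 'M[C]_n := tens1 F (perm_mx t).

Lemma perm_mx_entry (t : 'S_d) i j : perm_mx t i j = (t i == j)%:R :> C.
Proof. by rewrite !mxE. Qed.

Lemma blk_perm_fixed t : tau_fixed (is_RH F) J (blk_perm_mx t).
Proof. by apply: tens1_fixed => p q; rewrite perm_mx_entry rmorph_nat. Qed.

Lemma dg_blk_perm t : dg (blk_perm_mx t) = blk_perm_mx t^-1%g.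
Proof.
rewrite dg_tens1; congr tens1; apply/matrixP => i j; rewrite dgE !perm_mx_entry rmorph_nat.
by rewrite eq_sym -(inj_eq (@perm_inj _ t^-1%g)) permK.
Qed.

Lemma blk_perm_mxM s t : blk_perm_mx s *m blk_perm_mx t = blk_perm_mx (s * t)%g.
Proof. by rewrite /blk_perm_mx perm_mxM tens1M. Qed.

Lemma blk_perm_mx1 : blk_perm_mx 1%g = 1%:M.
Proof. by rewrite /blk_perm_mx perm_mx1 tens1_1. Qed.

Lemma blk_perm_unit t : blk_perm_mx t \in unitmx.
Proof.
have /mulmx1_unit[] // : blk_perm_mx t *m blk_perm_mx t^-1%g = 1%:M.
by rewrite blk_perm_mxM mulgV blk_perm_mx1.
Qed.

Lemma perm_mul_delta t p : perm_mx t *m delta_mx p p = delta_mx (t^-1%g p) p :> 'M[C]_d.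
Proof.
apply/matrixP => i j; rewrite -row_permE !mxE; congr (_%:R); congr (nat_of_bool (_ && _)).
by rewrite -(inj_eq (@perm_inj _ t^-1%g)) permK.
Qed.

Lemma blk_perm_unitC t p : blk_perm_mx t *m e p = e (t^-1%g p) *m blk_perm_mx t.
Proof.
rewrite !blk_unitE -!tens1M perm_mul_delta; congr tens1.
rewrite -{4}[t]invgK -col_permE; apply/matrixP => i j; rewrite !mxE.
by rewrite (inj_eq (@perm_inj _ t^-1%g)).
Qed.

Lemma blk_perm_unit_fix (t : 'S_d) p : t p = p -> blk_perm_mx t *m e p = e p.
Proof. by move=> tp; rewrite !blk_unitE -tens1M perm_mul_delta -{1}tp permK. Qed.

Lemma blk_perm_esum_fix (t : 'S_d) (X : {set 'I_d}) :
  (forall p, p \in X -> t p = p) -> blk_perm_mx t *m esum e X = esum e X.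
Proof.
by move=> tX; rewrite /esum mulmx_sumr; apply: eq_bigr => p /tX; apply: blk_perm_unit_fix.
Qed.

Lemma blk_perm_esgn (t : 'S_d) (X : {set 'I_d}) s : (forall p, (t p \in X) = (p \in X)) ->
  blk_perm_mx t *m esgn e X s *m dg (blk_perm_mx t) = esgn e X (s \o t).
Proof.
move=> tX; rewrite /esgn mulmx_sumr mulmx_suml.
rewrite (reindex_inj (@perm_inj _ t)) /=; apply: eq_big => // p _.
rewrite -scalemxAr -scalemxAl; congr (_ *: _).
by rewrite blk_perm_unitC permK dg_blk_perm -mulmxA blk_perm_mxM mulgV blk_perm_mx1 mulmx1.
Qed.

Definition rev_perm : 'S_d := perm (@rev_ord_inj d).
Local Notation Pr := (blk_perm_mx rev_perm).

Lemma rev_permV : rev_perm^-1%g = rev_perm.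
Proof.
apply/permP => i; apply: (@perm_inj _ rev_perm).
by rewrite permKV !permE rev_ordK.
Qed.

Lemma PrPr : Pr *m Pr = 1%:M.
Proof. by rewrite blk_perm_mxM -{1}rev_permV mulVg blk_perm_mx1. Qed.
Lemma dg_Pr : dg Pr = Pr. Proof. by rewrite dg_blk_perm rev_permV. Qed.
Lemma Pr_e p : Pr *m e p = e (rev_ord p) *m Pr.
Proof. by rewrite blk_perm_unitC rev_permV permE. Qed.

(** Reversing all [d * bsz F] indices reverses the order of the blocks, so the antisymmetry of the
    repeated indices descends to [K]. *)
Lemma rev_antisym (K : 'I_d -> int) :
  (forall i : 'I_n, K (blk (rev_ord i)) = - K (blk i)) ->
  forall p, K (rev_ord p) = - K p.
Proof.
move=> h p; have [i <- i0] := mkix p (bsz_gt0 F); rewrite -h; congr K.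
apply: val_inj => /=; have ip := divn_eq i (bsz F); rewrite i0 addn0 in ip.
have bd : (i %/ bsz F < d)%N by rewrite ltn_divLR ?bsz_gt0 // ltn_ord.
rewrite {2}ip; set q := (i %/ bsz F)%N in bd *.
have -> : (d * bsz F - (q * bsz F).+1 = (d - q.+1) * bsz F + (bsz F).-1)%N.
  have := bsz_gt0 F; case: (bsz F) => // b _; nia.
rewrite divnMDl ?bsz_gt0 // divn_small ?addn0 //.
by rewrite prednK ?bsz_gt0.
Qed.

Lemma D1E (K : 'I_d -> int) (s : 'I_d -> int) z :
  let Ep := esum e [set p | 0 < K p] in
  D1 F K s z = Pr *m (Ep *m Dz (fun i => K (blk i)) z) +
    Dz (fun i => - K (blk i)) z *m Ep *m Pr + esgn e [set p | K p == 0] s.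
Proof.
have DzE L : Dz (fun i : 'I_n => L (blk i)) z = \sum_p z ^ L p *: e p.
  exact: (Dz_sum (@blk F d) L z).
move=> Ep.
have hA : \sum_(m < d | 0 < K m) z ^ K m *: munit R F (rev_ord m) m =
    Pr *m (Ep *m Dz (fun i => K (blk i)) z).
  rewrite (DzE K) mulmx_sumr mulmx_sumr big_mkcond /=.
  apply: eq_bigr => p _; rewrite -!scalemxAr (mul_esum_e He) inE.
  case: ifP => _; last by rewrite mulmx0 scaler0.
  by rewrite munitE blk_unitE -tens1M perm_mul_delta rev_permV permE.
have hB : \sum_(m < d | 0 < K m) z ^ (- K m) *: munit R F m (rev_ord m) =
    Dz (fun i => - K (blk i)) z *m Ep *m Pr.
  rewrite (DzE (fun p => - K p)) !mulmx_suml big_mkcond /=.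
  apply: eq_bigr => p _; rewrite -!scalemxAl (mul_e_esum He) inE.
  case: ifP => _; last by rewrite mul0mx scaler0.
  rewrite -[e p *m Pr]dgK dgM dg_Pr (du_dg He) blk_unitE -tens1M perm_mul_delta.
  by rewrite munitE rev_permV permE dg_tens1 dg_delta.
have hC : \sum_(m < d | K m == 0) (s m)%:~R *: munit R F m m =
    esgn e [set p | K p == 0] s.
  rewrite /esgn; apply: eq_big => [p|p _]; first by rewrite inE.
  by rewrite munitE blk_unitE.
by rewrite /D1 hC big_split /= hA hB.
Qed.

Lemma mlaurent_D1 (K s : 'I_d -> int) : mlaurent (D1 F K s : C -> 'M[C]_n).
Proof.
apply: mlaurentD; last exact: mlaurentC.
by apply: mlaurent_sum => m; apply: mlaurentD; apply: mlaurentZ.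
Qed.

(** The algebra of [D1_sort]: [P] is the block reversal, which exchanges [Ep] and [Em], while [T]
    and [T'] permute only the index-zero blocks. *)
Lemma conj_model (P T T' Ep Em D D' S S' S'' : 'M[C]_n) :
  P *m P = 1%:M -> P *m Ep = Em *m P -> P *m Em = Ep *m P ->
  T *m Ep = Ep -> T *m Em = Em -> Ep *m T' = Ep -> Em *m T' = Em ->
  Ep *m D = D *m Ep -> Ep *m D' = D' *m Ep ->
  T *m S *m T' = S' -> P *m S' *m P = S'' ->
  P *m T *m (P *m (Ep *m D) + D' *m Ep *m P + S) *m (T' *m P) =
    Ep *m D *m P + P *m D' *m Ep + S''.
Proof.
move=> PP PEp PEm TEp TEm EpT EmT EpD EpD' <- <-.
rewrite !mulmxDr !mulmxDl; congr (_ + _ + _); last by rewrite !mulmxA.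
- have -> : P *m T *m (P *m (Ep *m D)) = P *m (T *m Em) *m P *m D.
    by rewrite -mulmxA [P *m (Ep *m _)]mulmxA PEp !mulmxA.
  rewrite TEm PEm -[Ep *m P *m P]mulmxA PP mulmx1 EpD.
  by rewrite mulmxA -[_ *m Ep *m T']mulmxA EpT.
have -> : P *m T *m (D' *m Ep *m P) *m (T' *m P) =
    P *m (T *m D' *m Ep) *m P *m T' *m P by rewrite !mulmxA.
rewrite -[T *m D' *m Ep]mulmxA -EpD' [T *m _]mulmxA TEp EpD'.
rewrite -!mulmxA [Ep *m (P *m _)]mulmxA -PEm -mulmxA [Em *m (T' *m _)]mulmxA EmT.
by rewrite [P *m (Em *m P)]mulmxA PEm -mulmxA PP mulmx1.
Qed.

(* Reversing the blocks turns the normal form with [z ^ K m] at [(m, rev m)]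
   into the one of [D1]; [t] sorts the signs. *)
Lemma D1_sort (K s : 'I_d -> int) (t : 'S_d) z :
  (forall p, K (rev_ord p) = - K p) -> perm_on [set p | K p == 0] t ->
  Pr *m blk_perm_mx t^-1%g *m D1 F K (fun p => s (rev_ord (t p))) z *m (blk_perm_mx t *m Pr) =
    esum e [set p | 0 < K p] *m Dz (fun i => K (blk i)) z *m Pr +
    Pr *m Dz (fun i => - K (blk i)) z *m esum e [set p | 0 < K p] +
    esgn e [set p | K p == 0] s.
Proof.
move=> Krev tX.
have tfix p : K p != 0 -> t p = p by move=> Kp; apply: (out_perm tX); rewrite inE.
have tVfix p : K p != 0 -> t^-1%g p = p by move=> /tfix tp; rewrite -{1}tp permK.
have tX0 p : (t^-1%g p \in [set p | K p == 0]) = (p \in [set p | K p == 0]).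
  by rewrite -[RHS](perm_closed _ (perm_onV tX)).
have dEp (X : {set 'I_d}) : dg (esum e X) = esum e X by apply: dg_esum He _.
have fixr (X : {set 'I_d}) :
    (forall p, p \in X -> K p != 0) -> esum e X *m blk_perm_mx t = esum e X.
  move=> XK; rewrite -[t]invgK -dg_blk_perm -{1}dEp -dgM blk_perm_esum_fix ?dEp // => p /XK.
  exact: tVfix.
have fixl (X : {set 'I_d}) :
    (forall p, p \in X -> K p != 0) -> blk_perm_mx t^-1%g *m esum e X = esum e X.
  by move=> XK; apply: blk_perm_esum_fix => p /XK; apply: tVfix.
rewrite (D1E K).
apply: (@conj_model _ _ _ _ (esum e [set p | K p < 0]) _ _ _
  (esgn e [set p | K p == 0] (fun p => s (rev_ord p)))).
- exact: PrPr.
- exact: (Pr_Xp Pr_e (@rev_ordK d) Krev).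
- exact: (Pr_Xm Pr_e (@rev_ordK d) Krev).
- by apply: fixl => p; rewrite inE => /gt_eqF ->.
- by apply: fixl => p; rewrite inE => /lt_eqF ->.
- by apply: fixr => p; rewrite inE => /gt_eqF ->.
- by apply: fixr => p; rewrite inE => /lt_eqF ->.
- exact: esum_Dz.
- exact: esum_Dz.
- have := blk_perm_esgn (fun p => s (rev_ord (t p))) tX0; rewrite dg_blk_perm invgK => ->.
  by apply: eq_bigr => p _; rewrite /= permKV.
have revX p : (rev_perm p \in [set p | K p == 0]) = (p \in [set p | K p == 0]).
  by rewrite !inE permE Krev oppr_eq0.
have := blk_perm_esgn (fun p => s (rev_ord p)) revX; rewrite dg_Pr => ->.
by apply: eq_bigr => p _; rewrite /= permE rev_ordK.
Qed.

Lemma wh_normal_form (A : lpoly R n) (K : 'I_d -> int) :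
  lpoly_inF A ->
  (forall z : C, z != 0 -> leval (ldag A) z = leval A z) ->
  sym_partial_indices A K ->
  (forall p, K (rev_ord p) = - K p) /\
  exists (M : 'M[{poly C}]_n) s, [/\ disk_unit M, is_RH F -> taup J M = M,
    (forall p, K p = 0 -> s p = 1 \/ s p = -1) &
    forall z, `|z| = 1 -> leval A z = ev M z *m
      (esum e [set p | 0 < K p] *m Dz (fun i => K (blk i)) z *m Pr +
       Pr *m Dz (fun i => - K (blk i)) z *m esum e [set p | 0 < K p] +
       esgn e [set p | K p == 0] s) *m dg (ev M z)].
Proof.
move=> FA Adag [Kd [Lp [Lm [pLp uLp pLm uLm AE]]]].
have [P0 P0E] := poly_of_lpoly pLp; have [Q0 Q0E] := poly_of_lpoly pLm.
pose k (i : 'I_n) := K (blk i).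
have uP0 : disk_unit P0 by move=> z z1; rewrite -P0E uLp.
have uQ0 : disk_unit Q0 by move=> z z1; rewrite -Q0E uLm.
have aE z : `|z| = 1 -> leval A z = ev P0 z *m Dz k z *m ev Q0 z^-1.
  move=> /circle_neq0 z0; rewrite AE // P0E; congr (_ *m _).
  by rewrite -Q0E leval_lsubinv invrK.
have ah z : `|z| = 1 -> dg (leval A z) = leval A z.
  move=> z1; have z0 := circle_neq0 z1.
  by have := Adag z z0; rewrite leval_ldag (conj_circle z1) invrK.
have [P [Q [uP uQ {}aE tP]]] : exists P Q, [/\ disk_unit P, disk_unit Q,
    (forall z, `|z| = 1 -> leval A z = ev P z *m Dz k z *m ev Q z^-1) &
    is_RH F -> taup J P = P].
  (* Over C there is no structure to restore; over R and H the left factor is made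
     [tau]-invariant. *)
  case: (boolP (is_RH F)) => hF; last by exists P0, Q0; split.
  have [||P [Q [uP uQ PQ tP]]] := wh_tau_fixed HJ uP0 uQ0 aE.
  - by move=> z _; apply: tau_leval.
  - by move=> z _; apply: (tau_Dz He K z hF).
  by exists P, Q; split.
have [U [V [UV {}aE Uc Vc]]] := wh_symmetrize uP uQ aE ah.
have Krev : forall p, K (rev_ord p) = - K p.
  apply: rev_antisym; apply: (@antisym_indices _ _ U V k) => //.
    move=> i j kij; apply/polyP => r; rewrite coef0 Uc //.
    by apply: lt_le_trans kij _.
  move=> i j kij; apply/polyP => r; rewrite coef0 Vc //.
  by apply: (@lt_le_trans _ _ 0); rewrite ?oppr_lt0.
split=> //.
have [|||G [s [uG tG s1 GE]]] := wh_reduce HJ He PrPr dg_Pr (@blk_perm_fixed rev_perm)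
  Pr_e (@rev_ordK d) Krev uP tP UV aE ah.
- by move=> hF z _; apply: tau_leval.
- by move=> i j r; rewrite mul1r; apply: Uc.
- by move=> i j r; rewrite mulN1r; apply: Vc.
exists (P *m G), s; split; [| |exact: s1|exact: GE].
- by move=> z z1; rewrite evM unitmx_mul uP ?uG.
- by move=> hF; rewrite (taupM HJ) (tP hF) (tG hF).
Qed.

End Assembly.

Theorem theorem3p2 (R : realType) (F : fkind) (d : nat)
  (A : lpoly R (d * bsz F)) (K : 'I_d -> int) (s : int) :
  lpoly_inF A ->
  (forall z : R[i], z != 0 -> leval (ldag A) z = leval A z) ->
  inv_on_circle A ->
  sym_partial_indices A K ->
  signature A s ->
  exists (Ap : lpoly R (d * bsz F)) (sg : 'I_d -> int),
    [/\ lpoly_inF Ap, is_polyz Ap & inv_on_disk Ap] /\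
    [/\ forall m : 'I_d, K m = 0 -> sg m = 1 \/ sg m = -1,
        forall m m' : 'I_d, K m = 0 -> K m' = 0 -> (m < m')%N -> sg m <= sg m' &
        \sum_(m < d | K m == 0) sg m = s] /\
    (forall z : R[i], z != 0 ->
       leval A z = leval Ap z *m D1 F K sg z *m leval (ldag Ap) z).
Proof.
move=> FA Adag _ KA [rs [cA sE]].
have HJ := structure_Jmx R F d; have He := blk_unit_units R F d.
have [Krev [M [s0 [uM tM s01 AE]]]] := wh_normal_form FA Adag KA.
(* The signs are sorted after composing with [rev_ord], because [Q] reverses the blocks besides
   permuting them. *)
have [t [tX tsort]] := sort_signs [set p | K p == 0] (s0 \o @rev_ord d).
pose Q : 'M[R[i]]_(d * bsz F) := blk_perm_mx R F (rev_perm d) *m blk_perm_mx R F t^-1%g.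
have fQ : tau_fixed (is_RH F) (Jmx R F d) Q by apply: tau_fixedM => //; apply: blk_perm_fixed.
exists (lpoly_of (M *m const_pmx Q)), (fun p => s0 (rev_ord (t p))); split; last split.
- split; [|exact: is_polyz_lpoly_of|].
    apply: lpoly_inF_of => hF; rewrite (taupM HJ) (tM hF); congr (_ *m _).
    by apply: ev_inj => z _; rewrite ev_taup // !ev_const fQ.
  by move=> z z1; rewrite leval_lpoly_of evM ev_const !unitmx_mul uM // !blk_perm_unit.
- split=> [m Km|m m' Km Km' mm'|].
  + apply: s01; rewrite Krev; apply/eqP; rewrite oppr_eq0.
    by have := perm_closed m tX; rewrite !inE Km eqxx.
  + by apply: tsort; rewrite ?inE ?Km ?Km'.
  have [dJ JJ trJ] := model_involution He (PrPr R F d) (dg_Pr R F d)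
    (@Pr_e R F d) (@rev_ordK d) Krev s01.
  have Dz1 (k : 'I_(d * bsz F) -> int) : Dz k 1 = 1%:M :> 'M[R[i]]_(d * bsz F).
    rewrite -diag_const_mx; congr diag_mx; apply/rowP => i.
    by rewrite !mxE exp1rz.
  have := AE 1 (normr1 _); rewrite !Dz1 !mulmx1 => A1E.
  have uM1 : ev M 1 \in unitmx by rewrite uM ?normr1.
  have := signature_involution dJ JJ uM1 A1E cA; rewrite {}trJ => cnt.
  (* [signature] counts complex eigenvalues, [bsz F] times [s]; each block unit has trace [bsz F],
     so the factor cancels. *)
  apply: (@mulfI _ (bsz F)%:Z); first by have := bsz_gt0 F; case: (bsz F).
  have tre (p : 'I_d) : \tr (blk_unit R F p) = (bsz F)%:R.
    rewrite blk_unitE mxtrace_tens1 /mxtrace (bigD1 p) //= mxE !eqxx big1 ?addr0 ?mulr1 //.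
    by move=> q /negPf qp; rewrite mxE qp.
  rewrite sE; apply: (@intr_inj R[i]).
  rewrite [RHS]rmorphB /= -!pmulrn cnt rmorphM /= rmorph_sum mulr_sumr /=.
  have inj_rt : injective (fun m => rev_ord (t m)) by move=> m m' /rev_ord_inj/perm_inj.
  rewrite [RHS](reindex_inj inj_rt) /=; apply: eq_big => m.
    by rewrite inE Krev oppr_eq0; have := perm_closed m tX; rewrite !inE.
  by move=> _; rewrite mulrC; congr (_ * _); rewrite -pmulrn -[LHS](tre (rev_ord (t m))).
(* Both sides are Laurent in [z], so it is enough to compare them on the circle, where the dagger is
   the pointwise conjugate transpose. *)
move=> z z0; have mL := @mlaurent_leval R (d * bsz F).
set Ap := lpoly_of _; set sg := fun p => _.
have mg : mlaurent (fun w => leval Ap w *m D1 F K sg w *m leval (ldag Ap) w).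
  by apply: mlaurentM; [apply: mlaurentM; [exact: mL|exact: mlaurent_D1]|exact: mL].
apply: (mlaurent_circle (mL A) mg) z0 => w w1.
rewrite leval_ldag (conj_circle w1) invrK leval_lpoly_of evM ev_const dgM.
have -> : dg Q = blk_perm_mx R F t *m blk_perm_mx R F (rev_perm d).
  by rewrite dgM dg_Pr dg_blk_perm invgK.
by rewrite (AE w w1) -(@D1_sort R F d K s0 t w Krev tX) /Q !mulmxA.
Qed.
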